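(* Let $\mathcal L_{\mathrm{LE}}$ be any LE-language. ALBA succeeds on all inductive $\mathcal L_{\mathrm{LE}}$-inequalities, and pivotal executions suffice; that is, for every inductive $\mathcal L_{\mathrm{LE}}$-inequality $\phi\le\psi$ there is a pivotal execution of ALBA on $\phi\le\psi$ which succeeds.
   Context: **Languages.** An order-type over $n$ is a tuple $\varepsilon\in\{1,\partial\}^n$; $1^\partial=\partial$, $\partial^\partial=1$, and $\varepsilon^\partial$ is obtained from $\varepsilon$ by swapping $1$ and $\partial$ in each coordinate. An LE-language $\mathcal L_{\mathrm{LE}}$ is given by a denumerable set $\mathsf{PROP}$ of propositional variables and disjoint sets $\mathcal F,\mathcal G$ of connectives, each $h\in\mathcal F\cup\mathcal G$ having an arity $n_h$ and an order-type $\varepsilon_h$ over $n_h$. Terms: $\phi::=p\mid\bot\mid\top\mid\phi\wedge\phi\mid\phi\vee\phi\mid f(\overline\phi)\mid g(\overline\phi)$. **Expanded language.** $\mathcal F^*\supseteq\mathcal F$ and $\mathcal G^*\supseteq\mathcal G$ are obtained by adding, for $f\in\mathcal F$ and $1\le i\le n_f$, an $n_f$-ary connective $f_i^\sharp$ (in $\mathcal G^*$ if $\varepsilon_f(i)=1$, in $\mathcal F^*$ if $\varepsilon_f(i)=\partial$) and, for $g\in\mathcal G$ and $1\le i\le n_g$, an $n_g$-ary connective $g_i^\flat$ (in $\mathcal F^*$ if $\varepsilon_g(i)=1$, in $\mathcal G^*$ if $\varepsilon_g(i)=\partial$). Order-types: for $k=h_i^\sharp$ or $k=h_i^\flat$,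 if $\varepsilon_h(i)=1$ then $\varepsilon_k(i)=1$ and $\varepsilon_k(j)=\varepsilon_h(j)^\partial$ for $j\ne i$; if $\varepsilon_h(i)=\partial$ then $\varepsilon_k(i)=\partial$ and $\varepsilon_k(j)=\varepsilon_h(j)$ for $j\neq i$. The terms of $\mathcal L_{\mathrm{LE}}^+$ are built from $\mathsf{PROP}$, $\bot,\top$, countably many nominals $\mathbf i,\mathbf j,\dots$ and co-nominals $\mathbf m,\mathbf n,\dots$ using $\wedge,\vee$ and $\mathcal F^*\cup\mathcal G^*$. An expression is pure if it contains no propositional variables. **Signs.** The signed generation tree $+s$ (resp. $-s$) of a term $s$ labels the root of its syntax tree with $+$ (resp. $-$) and propagates: children of $\wedge,\vee$ nodes get the same sign; the $i$-th child of a node labelled by a connective $h$ gets the same sign if $\varepsilon_h(i)=1$ and the opposite sign if $\varepsilon_h(i)=\partial$. A term $s$ is positive (negative) in $p$ if all occurrences of $p$ in $+s$ are signed $+$ ($-$). $\phi'(!x)$ means that $x$ occurs exactly once in $\phi'$; $\pm x\prec\ast s$ means that $x$ occurs with that sign in $\ast s$. **Classification of nodes.** Skeleton nodes: $\Delta$-adjoints ($+\vee$, $-\wedge$) and SLR nodes ($+f$ with $f\in\mathcal F$, $n_f\ge1$; $-g$ with $g\in\mathcal G$, $n_g\ge1$). PIA nodes: SRA nodes ($+\wedge$, $-\vee$, $+g$ with $g\in\mathcal G$, $n_g=1$, $-f$ with $f\in\mathcal F$, $n_f=1$) and SRR nodes ($+g$ with $g\in\mathcal G$, $n_g\ge2$;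 $-f$ with $f\in\mathcal F$, $n_f\ge2$). A branch is SLR if all its nodes other than its leaf are SLR nodes. A branch is good if it is the concatenation of two (possibly length $0$) paths $P_1$ and $P_2$, where $P_1$ starts at the leaf and, apart from variable nodes, consists only of PIA nodes, and $P_2$, apart from variable nodes, consists only of Skeleton nodes. **Inductive inequalities.** For an order-type $\epsilon$ over variables $p_1,\dots,p_n$, an $\epsilon$-critical node is a leaf $+p_i$ with $\epsilon_i=1$ or $-p_i$ with $\epsilon_i=\partial$; an $\epsilon$-critical branch is one starting from an $\epsilon$-critical node. A signed (sub)tree agrees with $\epsilon$ if all its variable leaves are $\epsilon$-critical. Let $\Omega$ be an irreflexive and transitive relation $<_\Omega$ on $p_1,\dots,p_n$. The signed tree $\ast s$ of $s(p_1,\dots,p_n)$ is $(\Omega,\epsilon)$-inductive if for every $1\le i\le n$: (1) every $\epsilon$-critical branch with leaf $p_i$ is good; (2) every $m$-ary SRR node on such a critical branch is of the form $\circledast(\gamma_1,\dots,\gamma_{j-1},\beta,\gamma_{j+1},\dots,\gamma_m)$, with the branch passing through $\beta$, where for every $h\ne j$ the subtree $\gamma_h$ with the sign inherited from $\ast s$ agrees with $\epsilon^\partial$, and $p_k<_\Omega p_i$ for every $p_k$ occurring in $\gamma_h$. An inequality $s\le t$ is $(\Omega,\epsilon)$-inductive if $+s$ and $-t$ are; it is inductive if it is $(\Omega,\epsilon)$-inductive for some $\Omega,\epsilon$. **ALBA.** Input: an $\mathcal L_{\mathrm{LE}}$-inequality $\phi\le\psi$. *Stage 1 (preprocessing).*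 Exhaustively: replace $\alpha(p)\le\beta(p)$ by $\alpha(\bot)\le\beta(\bot)$ if $\alpha$ is negative and $\beta$ positive in $p$; replace $\gamma(p)\le\delta(p)$ by $\gamma(\top)\le\delta(\top)$ if $\gamma$ is positive and $\delta$ negative in $p$. Then, considering $+$ of the left-hand side and $-$ of the right-hand side, exhaustively distribute positive $f\in\mathcal F$ nodes over $+\vee$ children (coordinates with $\varepsilon_f(i)=1$) and $-\wedge$ children (coordinates with $\varepsilon_f(i)=\partial$), turning them into joins of $f$-terms, and negative $g\in\mathcal G$ nodes over $-\wedge$ children ($\varepsilon_g(i)=1$) and $+\vee$ children ($\varepsilon_g(i)=\partial$), turning them into meets of $g$-terms; and exhaustively apply splitting: $\alpha\le\beta\wedge\gamma$ becomes $\alpha\le\beta$, $\alpha\le\gamma$; $\alpha\vee\beta\le\gamma$ becomes $\alpha\le\gamma$, $\beta\le\gamma$. This yields finitely many inequalities $\phi_i'\le\psi_i'$, each giving an initial system $(S_i,\mathsf{Ineq}_i)=(\emptyset,\phi_i'\le\psi_i')$. A system $(S,\mathsf{Ineq})$ (finite set of inequalities, inequality) represents the quasi-inequality ''conjunction of $S$ implies $\mathsf{Ineq}$''. *Stage 2 (reduction).* Each system is transformed separately by the following reduction rules, on $\mathcal L_{\mathrm{LE}}^+$-inequalities. (Approximation) For $\gamma\in\mathcal L_{\mathrm{LE}}$, $\mathbf j$ ($\mathbf m$) the first nominal (co-nominal) not occurring in the system, and the branch from the indicated occurrence of $x$ to the root being SLR: $(S,\phi'(\gamma/!x)\le\psi)$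 becomes $(S\cup\{\mathbf j\le\gamma\},\phi'(\mathbf j/!x)\le\psi)$ if $+x\prec+\phi'(!x)$, or $(S\cup\{\gamma\le\mathbf m\},\phi'(\mathbf m/!x)\le\psi)$ if $-x\prec+\phi'(!x)$; $(S,\phi\le\psi'(\gamma/!x))$ becomes $(S\cup\{\mathbf j\le\gamma\},\phi\le\psi'(\mathbf j/!x))$ if $+x\prec-\psi'(!x)$, or $(S\cup\{\gamma\le\mathbf m\},\phi\le\psi'(\mathbf m/!x))$ if $-x\prec-\psi'(!x)$. (Residuation, replacing an inequality in $S$) For $f\in\mathcal F$: $f(\phi_1,\dots,\phi_i,\dots,\phi_{n_f})\le\psi$ becomes $\phi_i\le f_i^\sharp(\phi_1,\dots,\psi,\dots,\phi_{n_f})$ if $\varepsilon_f(i)=1$, and $f_i^\sharp(\phi_1,\dots,\psi,\dots,\phi_{n_f})\le\phi_i$ if $\varepsilon_f(i)=\partial$. For $g\in\mathcal G$: $\psi\le g(\phi_1,\dots,\phi_i,\dots,\phi_{n_g})$ becomes $g_i^\flat(\phi_1,\dots,\psi,\dots,\phi_{n_g})\le\phi_i$ if $\varepsilon_g(i)=1$, and $\phi_i\le g_i^\flat(\phi_1,\dots,\psi,\dots,\phi_{n_g})$ if $\varepsilon_g(i)=\partial$. (Splitting) The splitting rules of Stage 1, applied in $S$. (Right Ackermann) $(\{\alpha_i\le p\mid1\le i\le n\}\cup\{\beta_j(p)\le\gamma_j(p)\mid1\le j\le m\},\mathsf{Ineq})$ becomes $(\{\beta_j(\bigvee_i\alpha_i)\le\gamma_j(\bigvee_i\alpha_i)\mid1\le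 j\le m\},\mathsf{Ineq})$, provided $p$ does not occur in any $\alpha_i$ or in $\mathsf{Ineq}$, the $\beta_j$ are positive in $p$ and the $\gamma_j$ negative in $p$. (Left Ackermann) $(\{p\le\alpha_i\mid1\le i\le n\}\cup\{\beta_j(p)\le\gamma_j(p)\mid1\le j\le m\},\mathsf{Ineq})$ becomes $(\{\beta_j(\bigwedge_i\alpha_i)\le\gamma_j(\bigwedge_i\alpha_i)\mid1\le j\le m\},\mathsf{Ineq})$, provided $p$ does not occur in any $\alpha_i$ or in $\mathsf{Ineq}$, the $\beta_j$ are negative in $p$ and the $\gamma_j$ positive in $p$. *Stage 3.* ALBA succeeds (in an execution) if every system has been made pure. Otherwise it fails. *Pivotal executions.* An application of an approximation rule is pivotal if the SLR branch from the root to the node $x$ is maximal, i.e. the root of the extracted subterm $\gamma$ (with its inherited sign) is not itself an SLR node. An execution is pivotal if approximation rules are applied only pivotally. *)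

(* Defs.v *)
From Stdlib Require List.
From Stdlib Require Import Relation_Operators.
From mathcomp Require Import all_boot.
From mathcomp Require Import boolp classical_sets.

Set Implicit Arguments.
Unset Strict Implicit.
Unset Printing Implicit Defensive.

Local Open Scope classical_set_scope.

(* Throughout, signs and the entries of order-types are booleans:
   [true] stands for + and for 1, [false] for - and for the dual entry. *)

Record LE_language := LELanguage {
  PROP : eqType;
  PROP_denumerable : exists v : nat -> PROP, bijective v;
  LE_F : Type;
  LE_G : Type;
  arity_F : LE_F -> nat;
  arity_G : LE_G -> nat;
  order_F : forall f : LE_F, 'I_(arity_F f) -> bool;
  order_G : forall g : LE_G, 'I_(arity_G g) -> bool
}.

(* The connectives of F* and G* together. Only F and G are residuated by the
   reduction rules, so the partition of the new connectives between F* and G*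
   plays no role; their order-types do. *)
Inductive conn (L : LE_language) :=
| CF of LE_F L
| CG of LE_G L
| Sharp (f : LE_F L) of 'I_(arity_F f)
| Flat (g : LE_G L) of 'I_(arity_G g).

Arguments Sharp {L}.
Arguments Flat {L}.

Definition arity (L : LE_language) (k : conn L) : nat :=
  match k with
  | CF f => arity_F f
  | CG g => arity_G g
  | Sharp f _ => arity_F f
  | Flat g _ => arity_G g
  end.

Definition residual_order n (e : 'I_n -> bool) (i : 'I_n) : 'I_n -> bool :=
  fun j => if j == i then e i else if e i then ~~ e j else e j.

Definition order_type (L : LE_language) (k : conn L) : 'I_(arity k) -> bool :=
  match k return 'I_(arity k) -> bool with
  | CF f => @order_F L f
  | CG g => @order_G L g
  | Sharp f i => residual_order (@order_F L f) i
  | Flat g i => residual_order (@order_G L g) i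
  end.

Inductive term (L : LE_language) :=
| Var of PROP L
| Nom of nat
| Conom of nat
| Bot
| Top
| Meet of term L & term L
| Join of term L & term L
| App (k : conn L) of ('I_(arity k) -> term L).

Arguments Nom {L}.
Arguments Conom {L}.
Arguments Bot {L}.
Arguments Top {L}.

Fixpoint in_LE (L : LE_language) (s : term L) : Prop :=
  match s with
  | Var _ | Bot | Top => True
  | Nom _ | Conom _ => False
  | Meet t u | Join t u => in_LE t /\ in_LE u
  | App (CF _) args | App (CG _) args => forall i, in_LE (args i)
  | App (Sharp _ _) _ | App (Flat _ _) _ => False
  end.

Definition update n (T : Type) (args : 'I_n -> T) (i : 'I_n) (t : T) :
  'I_n -> T := fun j => if j == i then t else args j.

Fixpoint subst (L : LE_language) (p : PROP L) (t s : term L) : term L :=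
  match s with
  | Var q => if q == p then t else s
  | Nom _ | Conom _ | Bot | Top => s
  | Meet u v => Meet (subst p t u) (subst p t v)
  | Join u v => Join (subst p t u) (subst p t v)
  | App k args => App (fun i => subst p t (args i))
  end.

(* Number of occurrences of a propositional variable. *)
Fixpoint occ (L : LE_language) (p : PROP L) (s : term L) : nat :=
  match s with
  | Var q => (q == p)
  | Nom _ | Conom _ | Bot | Top => 0
  | Meet t u | Join t u => occ p t + occ p u
  | App k args => \sum_(i < arity k) occ p (args i)
  end.

(* The empty join is Bot and the empty meet is Top. *)
Definition joins (L : LE_language) (r : seq (term L)) : term L :=
  if r is t :: r' then foldl (@Join L) t r' else Bot.

Definition meets (L : LE_language) (r : seq (term L)) : term L :=
  if r is t :: r' then foldl (@Meet L) t r' else Top.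

Definition child_sign (L : LE_language) (b : bool) (k : conn L)
  (i : 'I_(arity k)) : bool := if order_type i then b else ~~ b.

(* An inner node of a branch. For a connective the node records its arguments
   and the coordinate through which the branch passes. *)
Inductive node (L : LE_language) :=
| NMeet of bool
| NJoin of bool
| NConn (b : bool) (k : conn L) of ('I_(arity k) -> term L) & 'I_(arity k).

Arguments NMeet {L}.
Arguments NJoin {L}.

(* [path_to b s l c u]: in the generation tree of [s] with root sign [b], the
   nodes [l], listed from the root downwards, lead to an occurrence of the
   subterm [u] with sign [c] ([u] itself is not in [l]). *)
Inductive path_to (L : LE_language) :
  bool -> term L -> seq (node L) -> bool -> term L -> Prop :=
| path_here b s : path_to b s [::] b s
| path_meetl b s t l c u :
    path_to b s l c u -> path_to b (Meet s t) (NMeet b :: l) c u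
| path_meetr b s t l c u :
    path_to b t l c u -> path_to b (Meet s t) (NMeet b :: l) c u
| path_joinl b s t l c u :
    path_to b s l c u -> path_to b (Join s t) (NJoin b :: l) c u
| path_joinr b s t l c u :
    path_to b t l c u -> path_to b (Join s t) (NJoin b :: l) c u
| path_app b k (args : 'I_(arity k) -> term L) i l c u :
    path_to (child_sign b i) (args i) l c u ->
    path_to b (App args) (NConn b args i :: l) c u.

Definition occurs (L : LE_language) (u s : term L) : Prop :=
  exists l c, path_to true s l c u.

Definition positive_in (L : LE_language) (p : PROP L) (s : term L) : Prop :=
  forall l c, path_to true s l c (Var p) -> c = true.

Definition negative_in (L : LE_language) (p : PROP L) (s : term L) : Prop :=
  forall l c, path_to true s l c (Var p) -> c = false.

Definition pure (L : LE_language) (s : term L) : Prop :=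
  forall p : PROP L, ~ occurs (Var p) s.

Definition SLR_conn (L : LE_language) (b : bool) (k : conn L) : bool :=
  match k with
  | CF f => b && (1 <= arity_F f)
  | CG g => ~~ b && (1 <= arity_G g)
  | _ => false
  end.

Definition SRA_conn (L : LE_language) (b : bool) (k : conn L) : bool :=
  match k with
  | CF f => ~~ b && (arity_F f == 1)
  | CG g => b && (arity_G g == 1)
  | _ => false
  end.

Definition SRR_conn (L : LE_language) (b : bool) (k : conn L) : bool :=
  match k with
  | CF f => ~~ b && (2 <= arity_F f)
  | CG g => b && (2 <= arity_G g)
  | _ => false
  end.

Definition is_Delta_adjoint (L : LE_language) (x : node L) : bool :=
  match x with
  | NMeet b => ~~ b
  | NJoin b => b
  | NConn _ _ _ _ => false
  end.

Definition is_SLR (L : LE_language) (x : node L) : bool :=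
  if x is NConn b k _ _ then SLR_conn b k else false.

Definition is_SRA (L : LE_language) (x : node L) : bool :=
  match x with
  | NMeet b => b
  | NJoin b => ~~ b
  | NConn b k _ _ => SRA_conn b k
  end.

Definition is_SRR (L : LE_language) (x : node L) : bool :=
  if x is NConn b k _ _ then SRR_conn b k else false.

Definition is_skeleton (L : LE_language) (x : node L) : bool :=
  is_Delta_adjoint x || is_SLR x.

Definition is_PIA (L : LE_language) (x : node L) : bool :=
  is_SRA x || is_SRR x.

(* The root of the generation tree of [s] with root sign [b] is an SLR node. *)
Definition SLR_root (L : LE_language) (b : bool) (s : term L) : bool :=
  if s is App k _ then SLR_conn b k else false.

Definition SLR_branch (L : LE_language) (l : seq (node L)) : bool :=
  all (@is_SLR L) l.

(* [l] is listed from the root, hence the skeleton part comes first. *)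
Definition good_branch (L : LE_language) (l : seq (node L)) : Prop :=
  exists P2 P1 : seq (node L),
    [/\ l = P2 ++ P1, all (@is_skeleton L) P2 & all (@is_PIA L) P1].

(* The generation tree of [s] with root sign [b] agrees with [e]. *)
Definition agrees (L : LE_language) (e : PROP L -> bool) (b : bool)
    (s : term L) : Prop :=
  forall l c p, path_to b s l c (Var p) -> c = e p.

Definition dual_order (L : LE_language) (e : PROP L -> bool) : PROP L -> bool :=
  fun p => ~~ e p.

Definition side_condition (L : LE_language) (Omega : PROP L -> PROP L -> Prop)
    (e : PROP L -> bool) (p : PROP L) (x : node L) : Prop :=
  if x is NConn b k args j then
    forall h, h != j ->
      agrees (dual_order e) (child_sign b h) (args h) /\
      forall q, occurs (Var q) (args h) -> Omega q p
  else True.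

(* [Omega] and [e] are given on all variables; only their values on the
   variables of [s] matter. A branch leading to a leaf [Var p] is e-critical
   when the sign of that leaf is [e p]. *)
Definition inductive_tree (L : LE_language) (Omega : PROP L -> PROP L -> Prop)
    (e : PROP L -> bool) (b : bool) (s : term L) : Prop :=
  forall p l, path_to b s l (e p) (Var p) ->
    good_branch l /\
    forall x, List.In x l -> is_SRR x -> side_condition Omega e p x.

Record ineq (L : LE_language) := Leq { lhs : term L; rhs : term L }.

Definition inductive_ineq_for (L : LE_language)
    (Omega : PROP L -> PROP L -> Prop) (e : PROP L -> bool) (a : ineq L) :
    Prop :=
  inductive_tree Omega e true (lhs a) /\ inductive_tree Omega e false (rhs a).

Definition inductive_ineq (L : LE_language) (a : ineq L) : Prop :=
  exists (Omega : PROP L -> PROP L -> Prop) (e : PROP L -> bool),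
    [/\ forall p, ~ Omega p p,
        forall p q r, Omega p q -> Omega q r -> Omega p r &
        inductive_ineq_for Omega e a].

Definition occurs_ineq (L : LE_language) (u : term L) (a : ineq L) : Prop :=
  occurs u (lhs a) \/ occurs u (rhs a).

Definition exhaustively (T : Type) (R : T -> T -> Prop) (x y : T) : Prop :=
  clos_refl_trans_1n T R x y /\ ~ exists z, R y z.

(* [p] is required to occur, since otherwise the rules would do nothing and
   could be applied forever. *)
Inductive eliminate (L : LE_language) : ineq L -> ineq L -> Prop :=
| eliminate_bot p s t :
    occurs_ineq (Var p) (Leq s t) -> negative_in p s -> positive_in p t ->
    eliminate (Leq s t) (Leq (subst p Bot s) (subst p Bot t))
| eliminate_top p s t :
    occurs_ineq (Var p) (Leq s t) -> positive_in p s -> negative_in p t ->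
    eliminate (Leq s t) (Leq (subst p Top s) (subst p Top t)).

(* One distribution step at an arbitrary node of the tree of a term with the
   given root sign. A child [Join] of a positive [f] at a coordinate of
   order-type 1 is signed +, a child [Meet] at a coordinate of dual order-type
   is signed -; symmetrically for a negative [g]. *)
Inductive distribute (L : LE_language) : bool -> term L -> term L -> Prop :=
| distribute_F (f : LE_F L) (args : 'I_(arity (CF f)) -> term L) i s t :
    args i = (if order_type i then Join s t else Meet s t) ->
    distribute true (App args)
      (Join (App (update args i s)) (App (update args i t)))
| distribute_G (g : LE_G L) (args : 'I_(arity (CG g)) -> term L) i s t :
    args i = (if order_type i then Meet s t else Join s t) ->
    distribute false (App args)
      (Meet (App (update args i s)) (App (update args i t)))
| distribute_meetl b s s' t :
    distribute b s s' -> distribute b (Meet s t) (Meet s' t)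
| distribute_meetr b s t t' :
    distribute b t t' -> distribute b (Meet s t) (Meet s t')
| distribute_joinl b s s' t :
    distribute b s s' -> distribute b (Join s t) (Join s' t)
| distribute_joinr b s t t' :
    distribute b t t' -> distribute b (Join s t) (Join s t')
| distribute_app b k (args : 'I_(arity k) -> term L) i s' :
    distribute (child_sign b i) (args i) s' ->
    distribute b (App args) (App (update args i s')).

Inductive distribute_ineq (L : LE_language) : ineq L -> ineq L -> Prop :=
| distribute_lhs s s' t :
    distribute true s s' -> distribute_ineq (Leq s t) (Leq s' t)
| distribute_rhs s t t' :
    distribute false t t' -> distribute_ineq (Leq s t) (Leq s t').

Definition replace_in (L : LE_language) (S : set (ineq L)) (a : ineq L)
    (B : set (ineq L)) : set (ineq L) := (S `\ a) `|` B.

Inductive splitting (L : LE_language) : set (ineq L) -> set (ineq L) -> Prop :=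
| split_meet S s t u :
    S (Leq s (Meet t u)) ->
    splitting S (replace_in S (Leq s (Meet t u)) [set Leq s t; Leq s u])
| split_join S s t u :
    S (Leq (Join s t) u) ->
    splitting S (replace_in S (Leq (Join s t) u) [set Leq s u; Leq t u]).

Definition system (L : LE_language) : Type := (set (ineq L) * ineq L)%type.

Definition occurs_system (L : LE_language) (u : term L) (Q : system L) : Prop :=
  (exists2 a, Q.1 a & occurs_ineq u a) \/ occurs_ineq u Q.2.

Definition pure_ineq (L : LE_language) (a : ineq L) : Prop :=
  pure (lhs a) /\ pure (rhs a).

Definition pure_system (L : LE_language) (Q : system L) : Prop :=
  (forall a, Q.1 a -> pure_ineq a) /\ pure_ineq Q.2.

(* Positive occurrences are approximated by nominals from below, negative ones
   by co-nominals from above. *)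
Definition name (L : LE_language) (b : bool) (n : nat) : term L :=
  if b then Nom n else Conom n.

Definition name_ineq (L : LE_language) (b : bool) (n : nat) (t : term L) :
  ineq L := if b then Leq (Nom n) t else Leq t (Conom n).

Definition first_fresh (L : LE_language) (b : bool) (n : nat) (Q : system L) :
    Prop :=
  ~ occurs_system (name L b n) Q /\
  forall k, k < n -> occurs_system (name L b k) Q.

(* [approximation b t Q Q']: the extracted subterm is [t], of sign [b]. *)
Inductive approximation (L : LE_language) (b : bool) (t : term L) :
  system L -> system L -> Prop :=
| approximation_lhs S (s r : term L) x l n :
    in_LE t -> occ x s = 1 -> path_to true s l b (Var x) -> SLR_branch l ->
    first_fresh b n (S, Leq (subst x t s) r) ->
    approximation b t (S, Leq (subst x t s) r)
      (S `|` [set name_ineq b n t], Leq (subst x (name L b n) s) r)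
| approximation_rhs S (s r : term L) x l n :
    in_LE t -> occ x r = 1 -> path_to false r l b (Var x) -> SLR_branch l ->
    first_fresh b n (S, Leq s (subst x t r)) ->
    approximation b t (S, Leq s (subst x t r))
      (S `|` [set name_ineq b n t], Leq s (subst x (name L b n) r)).

Inductive residuate (L : LE_language) : ineq L -> ineq L -> Prop :=
| residuate_F (f : LE_F L) (args : 'I_(arity_F f) -> term L) i s :
    order_F i ->
    residuate (Leq (@App L (CF f) args) s)
      (Leq (args i) (@App L (Sharp f i) (update args i s)))
| residuate_F_dual (f : LE_F L) (args : 'I_(arity_F f) -> term L) i s :
    ~~ order_F i ->
    residuate (Leq (@App L (CF f) args) s)
      (Leq (@App L (Sharp f i) (update args i s)) (args i))
| residuate_G (g : LE_G L) (args : 'I_(arity_G g) -> term L) i s :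
    order_G i ->
    residuate (Leq s (@App L (CG g) args))
      (Leq (@App L (Flat g i) (update args i s)) (args i))
| residuate_G_dual (g : LE_G L) (args : 'I_(arity_G g) -> term L) i s :
    ~~ order_G i ->
    residuate (Leq s (@App L (CG g) args))
      (Leq (args i) (@App L (Flat g i) (update args i s))).

Inductive right_Ackermann (L : LE_language) : system L -> system L -> Prop :=
| right_Ackermann_rule n m (alpha : 'I_n -> term L)
    (beta gamma : 'I_m -> term L) (p : PROP L) (a : ineq L) :
    (forall i, ~ occurs (Var p) (alpha i)) ->
    ~ occurs_ineq (Var p) a ->
    (forall j, positive_in p (beta j)) ->
    (forall j, negative_in p (gamma j)) ->
    right_Ackermann
      (range (fun i => Leq (alpha i) (Var p)) `|`
       range (fun j => Leq (beta j) (gamma j)), a)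
      (range (fun j => Leq (subst p (joins (codom alpha)) (beta j))
                           (subst p (joins (codom alpha)) (gamma j))), a).

Inductive left_Ackermann (L : LE_language) : system L -> system L -> Prop :=
| left_Ackermann_rule n m (alpha : 'I_n -> term L)
    (beta gamma : 'I_m -> term L) (p : PROP L) (a : ineq L) :
    (forall i, ~ occurs (Var p) (alpha i)) ->
    ~ occurs_ineq (Var p) a ->
    (forall j, negative_in p (beta j)) ->
    (forall j, positive_in p (gamma j)) ->
    left_Ackermann
      (range (fun i => Leq (Var p) (alpha i)) `|`
       range (fun j => Leq (beta j) (gamma j)), a)
      (range (fun j => Leq (subst p (meets (codom alpha)) (beta j))
                           (subst p (meets (codom alpha)) (gamma j))), a).

Inductive rule (L : LE_language) :=
| Approximation of bool & term L
| Residuation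
| Splitting
| RightAckermann
| LeftAckermann.

Definition apply_rule (L : LE_language) (r : rule L) (Q Q' : system L) : Prop :=
  match r with
  | Approximation b t => approximation b t Q Q'
  | Residuation =>
      exists a b, [/\ Q.1 a, residuate a b &
                      Q' = (replace_in Q.1 a [set b], Q.2)]
  | Splitting => splitting Q.1 Q'.1 /\ Q'.2 = Q.2
  | RightAckermann => right_Ackermann Q Q'
  | LeftAckermann => left_Ackermann Q Q'
  end.

Definition pivotal_rule (L : LE_language) (r : rule L) : bool :=
  if r is Approximation b t then ~~ SLR_root b t else true.

(* A run is the list of the rules applied, each with the resulting system. *)
Fixpoint is_run (L : LE_language) (Q : system L)
    (tr : seq (rule L * system L)) : Prop :=
  if tr is (r, Q') :: tr' then apply_rule r Q Q' /\ is_run Q' tr' else True.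

Definition final_system (L : LE_language) (Q : system L)
    (tr : seq (rule L * system L)) : system L := last Q (map snd tr).

Definition initial_system (L : LE_language) (a : ineq L) : system L := (set0, a).

Record execution (L : LE_language) (a : ineq L) := Execution {
  ex_eliminated : ineq L;
  ex_distributed : ineq L;
  ex_preprocessed : set (ineq L);
  ex_run : ineq L -> seq (rule L * system L);
  ex_eliminatedP : exhaustively (@eliminate L) a ex_eliminated;
  ex_distributedP :
    exhaustively (@distribute_ineq L) ex_eliminated ex_distributed;
  ex_preprocessedP :
    exhaustively (@splitting L) [set ex_distributed] ex_preprocessed;
  ex_runP : forall c, ex_preprocessed c -> is_run (initial_system c) (ex_run c)
}.

Definition succeeds (L : LE_language) (a : ineq L) (E : execution a) : Prop :=
  forall c, ex_preprocessed E c ->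
    pure_system (final_system (initial_system c) (ex_run E c)).

Definition pivotal (L : LE_language) (a : ineq L) (E : execution a) : Prop :=
  forall c, ex_preprocessed E c ->
    all (fun step => pivotal_rule step.1) (ex_run E c).

(* Main.v *)
(** Inductiveness survives preprocessing: no step creates variable occurrences
    with new signs, and distribution only exchanges adjacent skeleton nodes.
    In a fully distributed and split inequality no Delta-adjoint can be reached
    from the root through SLR nodes, so maximal SLR branches end at subterms
    all of whose critical branches consist of PIA nodes. Extracting every such
    subterm that contains a variable makes the main inequality pure. Splitting
    and residuating along critical branches then yields inequalities that
    either bound a critical variable [p] by a term, or contain no critical
    occurrence. Residuation preserves the sign of every occurrence, and by the
    side conditions on SRR nodes the bound of [p] has only noncritical
    variables, all of them below [p] in the dependency order. Since that order
    is transitive and irreflexive, this shape is preserved by the Ackermann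
    rules, so the variables can be eliminated in any order. *)

From Stdlib Require List.
From Stdlib Require Import Relation_Operators.
From mathcomp Require Import all_boot.
From mathcomp Require Import boolp classical_sets.
Require Import Defs.

Set Implicit Arguments.
Unset Strict Implicit.
Unset Printing Implicit Defensive.

Local Open Scope classical_set_scope.

(** * Signed occurrences of variables *)

Section Occurrences.
Variable L : LE_language.
Implicit Types (s t u : term L) (b c : bool) (p q : PROP L) (l : seq (node L)).

(** Inversion by a match on the term: case analysis on an [App] then yields no equality between
    dependent pairs. *)
Lemma path_inv b s l c u : path_to b s l c u ->
  [/\ l = [::], c = b & u = s] \/
  match s with
  | Meet t v => exists l', l = NMeet b :: l' /\
      (path_to b t l' c u \/ path_to b v l' c u)
  | Join t v => exists l', l = NJoin b :: l' /\
      (path_to b t l' c u \/ path_to b v l' c u)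
  | App k args => exists i l', l = NConn b args i :: l' /\
      path_to (child_sign b i) (args i) l' c u
  | _ => False
  end.
Proof.
case=> {b s l c u}.
- by left.
- by move=> b s t l c u h; right; exists l; split; [|left].
- by move=> b s t l c u h; right; exists l; split; [|right].
- by move=> b s t l c u h; right; exists l; split; [|left].
- by move=> b s t l c u h; right; exists l; split; [|right].
- by move=> b k args i l c u h; right; exists i, l.
Qed.

Definition signed_occ b s c p := exists l, path_to b s l c (Var p).

Lemma socc_Var b q c p : signed_occ b (Var q) c p <-> c = b /\ p = q.
Proof.
split=> [[l /path_inv[[_ -> [->]] | //]] // | [-> ->]].
by exists [::]; constructor.
Qed.

Lemma socc_Nom b n c p : ~ signed_occ b (Nom n) c p.
Proof. by case=> l /path_inv[[] | ]. Qed.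

Lemma socc_Conom b n c p : ~ signed_occ b (Conom n) c p.
Proof. by case=> l /path_inv[[] | ]. Qed.

Lemma socc_name b b' n c p : ~ signed_occ b (name L b' n) c p.
Proof. by case: b'; [exact: socc_Nom | exact: socc_Conom]. Qed.

Lemma socc_Bot b c p : ~ signed_occ b Bot c p.
Proof. by case=> l /path_inv[[] | ]. Qed.

Lemma socc_Top b c p : ~ signed_occ b Top c p.
Proof. by case=> l /path_inv[[] | ]. Qed.

Lemma socc_Meet b s t c p :
  signed_occ b (Meet s t) c p <-> signed_occ b s c p \/ signed_occ b t c p.
Proof.
split=> [[l /path_inv[[] // | [l' [_ []]]]] | [] [l h]].
- by left; exists l'.
- by right; exists l'.
- by exists (NMeet b :: l); apply: path_meetl.
- by exists (NMeet b :: l); apply: path_meetr.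
Qed.

Lemma socc_Join b s t c p :
  signed_occ b (Join s t) c p <-> signed_occ b s c p \/ signed_occ b t c p.
Proof.
split=> [[l /path_inv[[] // | [l' [_ []]]]] | [] [l h]].
- by left; exists l'.
- by right; exists l'.
- by exists (NJoin b :: l); apply: path_joinl.
- by exists (NJoin b :: l); apply: path_joinr.
Qed.

Lemma socc_App b k (args : 'I_(arity k) -> term L) c p :
  signed_occ b (App args) c p <->
  exists i, signed_occ (child_sign b i) (args i) c p.
Proof.
split=> [[l /path_inv[[] // | [i [l' [_ h]]]]] | [i [l h]]].
- by exists i, l'.
- by exists (NConn b args i :: l); apply: path_app.
Qed.

Lemma child_signN b (k : conn L) (i : 'I_(arity k)) :
  child_sign (~~ b) i = ~~ child_sign b i :> bool.
Proof. by rewrite /child_sign; case: ifP. Qed.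

Lemma path_flip b s l c u :
  path_to b s l c u -> exists l', path_to (~~ b) s l' (~~ c) u.
Proof.
elim=> {b s l c u}.
- by move=> b s; exists [::]; constructor.
- by move=> b s t l c u _ [l' h]; exists (NMeet (~~ b) :: l'); apply: path_meetl.
- by move=> b s t l c u _ [l' h]; exists (NMeet (~~ b) :: l'); apply: path_meetr.
- by move=> b s t l c u _ [l' h]; exists (NJoin (~~ b) :: l'); apply: path_joinl.
- by move=> b s t l c u _ [l' h]; exists (NJoin (~~ b) :: l'); apply: path_joinr.
- move=> b k args i l c u _ [l' h]; exists (NConn (~~ b) args i :: l').
  by apply: path_app; rewrite child_signN.
Qed.

Lemma socc_flip b s c p : signed_occ b s c p -> signed_occ (~~ b) s (~~ c) p.
Proof. by case=> l /path_flip. Qed.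

(** [occurs] fixes the root sign +; flipping every sign along a path makes any root sign
    available. *)
Lemma occursE b s p : occurs (Var p) s <-> exists c, signed_occ b s c p.
Proof.
split=> [[l [c h]] | [c [l h]]].
- by case: b; [exists c, l | exists (~~ c); apply: (@socc_flip true); exists l].
- case: b h => h; first by exists l, c.
  by case: (path_flip h) => l' h'; exists l', (~~ c).
Qed.

Definition in_LE_ineq (a : ineq L) := in_LE (lhs a) /\ in_LE (rhs a).

(** Repetitions are kept: the length counts variable occurrences, and this count is the termination
    measure of both elimination and approximation. *)
Fixpoint vars s : seq (PROP L) :=
  match s with
  | Var p => [:: p]
  | Nom _ | Conom _ | Bot | Top => [::]
  | Meet t u | Join t u => vars t ++ vars u
  | App k args => \big[cat/[::]]_(i < arity k) vars (args i)
  end.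

Lemma mem_bigcat (T : eqType) n (F : 'I_n -> seq T) x :
  reflect (exists i, x \in F i) (x \in \big[cat/[::]]_(i < n) F i).
Proof.
apply: (iffP idP) => [|[i xi]]; last first.
  elim: n F i xi => [F []//|n IH F i xi].
  rewrite big_ord_recl mem_cat; case: (unliftP ord0 i) xi => [j ->|->] xi.
    by rewrite (IH (fun i => F (lift ord0 i)) j) ?orbT.
  by rewrite xi.
elim/big_rec: _ => // i r _ IH; rewrite mem_cat => /orP[xi|/IH//].
by exists i.
Qed.

Lemma in_varsP s p : p \in vars s <-> occurs (Var p) s.
Proof.
rewrite (occursE true); move: true => b.
elim: s b => [q|n|n|||s IHs t IHt|s IHs t IHt|k args IH] b /=.
- rewrite inE; split=> [/eqP->|[c /socc_Var[_ ->]]//].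
  by exists b; apply/socc_Var.
- by split=> // -[c /socc_Nom].
- by split=> // -[c /socc_Conom].
- by split=> // -[c /socc_Bot].
- by split=> // -[c /socc_Top].
- rewrite mem_cat; split=> [/orP[/(IHs b)|/(IHt b)][c h]|[c /socc_Meet[h|h]]].
  + by exists c; apply/socc_Meet; left.
  + by exists c; apply/socc_Meet; right.
  + by apply/orP; left; apply/(IHs b); exists c.
  + by apply/orP; right; apply/(IHt b); exists c.
- rewrite mem_cat; split=> [/orP[/(IHs b)|/(IHt b)][c h]|[c /socc_Join[h|h]]].
  + by exists c; apply/socc_Join; left.
  + by exists c; apply/socc_Join; right.
  + by apply/orP; left; apply/(IHs b); exists c.
  + by apply/orP; right; apply/(IHt b); exists c.
- split=> [/mem_bigcat[i /(IH i (child_sign b i))[c h]]|[c /socc_App[i h]]].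
  + by exists c; apply/socc_App; exists i.
  + by apply/mem_bigcat; exists i; apply/(IH i (child_sign b i)); exists c.
Qed.

Lemma socc_in_vars b s c p : signed_occ b s c p -> p \in vars s.
Proof. by move=> h; apply/in_varsP/(occursE b); exists c. Qed.

Lemma in_vars_socc b s p : p \in vars s -> exists c, signed_occ b s c p.
Proof. by move/in_varsP/(occursE b). Qed.

Lemma pureP s : pure s <-> vars s = [::].
Proof.
split=> [h|h p /in_varsP]; last by rewrite h.
by case: (vars s) (in_varsP s) => // p r /(_ p)[hp _]; case: (h p); apply: hp; rewrite inE eqxx.
Qed.

Lemma occE p s : occ p s = count_mem p (vars s).
Proof.
elim: s => [q|n|n|||s IHs t IHt|s IHs t IHt|k args IH] //=.
- by rewrite addn0.
- by rewrite count_cat IHs IHt.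
- by rewrite count_cat IHs IHt.
- transitivity (\sum_(i < arity k) count_mem p (vars (args i))).
    by apply: eq_bigr => i _.
  have: forall n (F : 'I_n -> seq (PROP L)), \sum_(i < n) count_mem p (F i) =
      count_mem p (\big[cat/[::]]_(i < n) F i); last exact.
  elim=> [|n IHn] F.
    by rewrite !big_ord0.
  by rewrite !big_ord_recl count_cat IHn.
Qed.

Lemma occ_eq0 p s : (occ p s == 0) = (p \notin vars s).
Proof. by rewrite occE -leqn0 leqNgt -has_count has_pred1. Qed.

Lemma size_bigcat (T : Type) n (F : 'I_n -> seq T) :
  size (\big[cat/[::]]_(i < n) F i) = \sum_(i < n) size (F i).
Proof. by elim/big_rec2: _ => // i m r _ <-; rewrite size_cat. Qed.

(** Each occurrence of [p] is traded for [size (vars t)] occurrences; the additive form avoids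
    truncated subtraction. *)
Lemma size_vars_subst p t s :
  size (vars (subst p t s)) + occ p s = size (vars s) + occ p s * size (vars t).
Proof.
elim: s => [q|n|n|||s IHs u IHu|s IHs u IHu|k args IH] //=.
- by case: ifP => _ /=; rewrite ?mul1n 1?addnC.
- by rewrite !size_cat mulnDl addnACA IHs IHu addnACA.
- by rewrite !size_cat mulnDl addnACA IHs IHu addnACA.
- rewrite !size_bigcat big_distrl -!big_split /=.
  by apply: eq_bigr => i _.
Qed.

Lemma subst_notin p t s : p \notin vars s -> subst p t s = s.
Proof.
elim: s => [q|n|n|||s IHs u IHu|s IHs u IHu|k args IH] //=.
- by rewrite inE eq_sym => /negbTE->.
- by rewrite mem_cat negb_or => /andP[/IHs-> /IHu->].
- by rewrite mem_cat negb_or => /andP[/IHs-> /IHu->].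
- move=> /mem_bigcat h; congr App; apply: funext => i; apply: IH.
  by apply/negP => hi; apply: h; exists i.
Qed.

(** Signs compose: a copy of [t] is read with the sign of the occurrence of [p] that it replaces. *)
Lemma socc_subst b p t s c q : signed_occ b (subst p t s) c q ->
  (q <> p /\ signed_occ b s c q) \/
  exists2 c', signed_occ b s c' p & signed_occ c' t c q.
Proof.
elim: s b => [q'|n|n|||s IHs u IHu|s IHs u IHu|k args IH] b /=.
- case: ifP => [/eqP->|/eqP ne] h; last by left; case/socc_Var: h => -> ->; split=> //; apply/socc_Var.
  by right; exists b => //; apply/socc_Var.
- by move/socc_Nom.
- by move/socc_Conom.
- by move/socc_Bot.
- by move/socc_Top.
- case/socc_Meet => [/IHs|/IHu] [[ne h]|[c' h h']].
  + by left; split=> //; apply/socc_Meet; left.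
  + by right; exists c' => //; apply/socc_Meet; left.
  + by left; split=> //; apply/socc_Meet; right.
  + by right; exists c' => //; apply/socc_Meet; right.
- case/socc_Join => [/IHs|/IHu] [[ne h]|[c' h h']].
  + by left; split=> //; apply/socc_Join; left.
  + by right; exists c' => //; apply/socc_Join; left.
  + by left; split=> //; apply/socc_Join; right.
  + by right; exists c' => //; apply/socc_Join; right.
- case/socc_App => i /IH [[ne h]|[c' h h']].
  + by left; split=> //; apply/socc_App; exists i.
  + by right; exists c' => //; apply/socc_App; exists i.
Qed.

Lemma vars_subst p t s q :
  q \in vars (subst p t s) -> (q <> p /\ q \in vars s) \/ (p \in vars s /\ q \in vars t).
Proof.
case/(in_vars_socc true) => c /socc_subst[[ne /socc_in_vars]|[c' /socc_in_vars ? /socc_in_vars]].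
- by left.
- by right.
Qed.

(** Supplies the placeholder variable of the approximation rules. *)
Lemma exists_fresh (r : seq (PROP L)) : exists x, x \notin r.
Proof.
case: (PROP_denumerable L) => v [v' vK v'K].
(* Its index in the enumeration [v] exceeds that of every entry of [r]. *)
exists (v (\max_(p <- r) v' p).+1); apply/negP => h.
suff: v' (v (\max_(p <- r) v' p).+1) <= \max_(p <- r) v' p by rewrite vK ltnn.
exact: leq_bigmax_seq.
Qed.

End Occurrences.

(** * Inductive trees under preprocessing *)

Section Inductive.
Variables (L : LE_language) (Omega : PROP L -> PROP L -> Prop).
Variable e : PROP L -> bool.
Implicit Types (s t u : term L) (b c : bool) (p q : PROP L).
Implicit Types (x : node L) (l : seq (node L)).

Lemma agreesE d b s : agrees d b s <-> forall c p, signed_occ b s c p -> c = d p.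
Proof.
split=> [h c p [l]|h l c p hl]; first exact: h.
by apply: h; exists l.
Qed.

Fixpoint PIA_branch p l : Prop :=
  if l is x :: l' then
    [/\ is_PIA x, is_SRR x -> side_condition Omega e p x & PIA_branch p l']
  else True.

(** A good branch with its side conditions, in recursive form from the root. The skeleton part needs
    no side condition, because no SRR node is a skeleton node. *)
Fixpoint ind_branch p l : Prop :=
  if l is x :: l' then is_skeleton x /\ ind_branch p l' \/ PIA_branch p l
  else True.

Lemma PIA_not_skeleton x : is_PIA x -> is_skeleton x = false.
Proof.
by case: x => [[]|[]|b [f|g|f i|g i] args j] //=;
  rewrite /is_PIA /is_skeleton /=; case: b.
Qed.

Lemma SRR_PIA x : is_SRR x -> is_PIA x.
Proof. by rewrite /is_PIA => ->; rewrite orbT. Qed.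

Lemma PIA_branchP p l : PIA_branch p l <->
  all (@is_PIA L) l /\
  forall x, List.In x l -> is_SRR x -> side_condition Omega e p x.
Proof.
elim: l => [|x l IH] //=; split=> [[-> hx /IH[-> hl]]|[/andP[-> hl] h]].
  by split=> // y [<-|/hl].
split=> //; first exact: h (or_introl erefl).
by apply/IH; split=> // y hy; apply: h; right.
Qed.

Lemma ind_branchP p l : ind_branch p l <->
  good_branch l /\
  forall x, List.In x l -> is_SRR x -> side_condition Omega e p x.
Proof.
elim: l => [|x l IH] /=; first by split=> // _; split=> //; exists [::], [::].
split=> [[[sx /IH[[P2 [P1 [-> h2 h1]]] hl]]|h]|[[P2 [P1 [E h2 h1]]] h]].
- split; first by exists (x :: P2), P1; rewrite /= sx.
  by move=> y [<-|/hl//] /SRR_PIA/PIA_not_skeleton; rewrite sx.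
- have /(PIA_branchP p (x :: l))[hP hs] := h.
  by split=> //; exists [::], (x :: l).
- case: P2 E h2 => [|y P2] /= E h2.
    by right; apply/(PIA_branchP p (x :: l)); rewrite E; split=> // y; rewrite -E; apply: h.
  case: E h2 => <- E /andP[sx h2]; left; split=> //; apply/IH; split.
    by exists P2, P1.
  by move=> z hz; apply: h; right.
Qed.

Lemma inductive_treeE b s : inductive_tree Omega e b s <->
  forall p l, path_to b s l (e p) (Var p) -> ind_branch p l.
Proof.
by split=> h p l /h; [move/ind_branchP|move/ind_branchP].
Qed.

(** * Preservation of inductiveness by preprocessing steps *)

Definition node_sim x x' :=
  [/\ is_skeleton x' = is_skeleton x, is_PIA x' = is_PIA x,
      is_SRR x' = is_SRR x &
      forall p, side_condition Omega e p x -> side_condition Omega e p x'].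

(** The PIA clause is carried along because [ind_branch] may switch to [PIA_branch] at any node;
    only both clauses together are stable under [cons]. *)
Definition branch_sim l l' := forall p,
  (PIA_branch p l -> PIA_branch p l') /\ (ind_branch p l -> ind_branch p l').

(* The relation between a tree [s] and its image [t] under a preprocessing step,
   which may delete and duplicate occurrences but does not create new ones. *)
Definition tree_sim b s t := forall l' c q, path_to b t l' c (Var q) ->
  exists2 l, path_to b s l c (Var q) & branch_sim l l'.

Lemma branch_sim_cons x x' l l' :
  node_sim x x' -> branch_sim l l' -> branch_sim (x :: l) (x' :: l').
Proof.
move=> [sk pia srr side] ll' p; have [hP hI] := ll' p.
have hP' : PIA_branch p (x :: l) -> PIA_branch p (x' :: l').
  by move=> /= [xP xs /hP]; rewrite pia srr; split=> // /xs/side.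
split=> // -[[hx /hI hl]|/hP']; last by right.
by left; rewrite sk.
Qed.

Lemma node_sim_refl x : node_sim x x.
Proof. by []. Qed.

Lemma tree_sim_refl b s : tree_sim b s s.
Proof. by move=> l c q h; exists l. Qed.

Lemma tree_sim_socc b s t c q : tree_sim b s t ->
  signed_occ b t c q -> signed_occ b s c q.
Proof. by move=> st [l /st[l' h _]]; exists l'. Qed.

Lemma tree_sim_inductive b s t : tree_sim b s t ->
  inductive_tree Omega e b s -> inductive_tree Omega e b t.
Proof.
move=> st /inductive_treeE h; apply/inductive_treeE => p l /st[l' /h hl' sl].
exact: (sl p).2.
Qed.

Lemma tree_sim_leaf b s t : (forall c q, ~ signed_occ b t c q) -> tree_sim b s t.
Proof. by move=> h l c q hl; case: (h c q); exists l. Qed.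

Lemma tree_sim_Meet b s s' t t' : tree_sim b s s' -> tree_sim b t t' ->
  tree_sim b (Meet s t) (Meet s' t').
Proof.
move=> hs ht l c q /path_inv[[]//|[l' [-> []]]] => [/hs|/ht] [l0 h0 h1].
- exists (NMeet b :: l0); first exact: path_meetl.
  exact: branch_sim_cons (node_sim_refl _) h1.
- exists (NMeet b :: l0); first exact: path_meetr.
  exact: branch_sim_cons (node_sim_refl _) h1.
Qed.

Lemma tree_sim_Join b s s' t t' : tree_sim b s s' -> tree_sim b t t' ->
  tree_sim b (Join s t) (Join s' t').
Proof.
move=> hs ht l c q /path_inv[[]//|[l' [-> []]]] => [/hs|/ht] [l0 h0 h1].
- exists (NJoin b :: l0); first exact: path_joinl.
  exact: branch_sim_cons (node_sim_refl _) h1.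
- exists (NJoin b :: l0); first exact: path_joinr.
  exact: branch_sim_cons (node_sim_refl _) h1.
Qed.

Lemma node_sim_App b k (args args' : 'I_(arity k) -> term L) i :
  (forall j, tree_sim (child_sign b j) (args j) (args' j)) ->
  node_sim (NConn b args i) (NConn b args' i).
Proof.
move=> h; split=> // p /= side j /side[ag oc]; split.
  move/agreesE: ag => ag; apply/agreesE => c q /(tree_sim_socc (h j)); exact: ag.
move=> q /(occursE (child_sign b j))[c /(tree_sim_socc (h j)) hc]; apply: oc.
by apply/(occursE (child_sign b j)); exists c.
Qed.

Lemma tree_sim_App b k (args args' : 'I_(arity k) -> term L) :
  (forall j, tree_sim (child_sign b j) (args j) (args' j)) ->
  tree_sim b (App args) (App args').
Proof.
move=> h l c q /path_inv[[]//|[i [l' [-> /h[l0 h0 h1]]]]].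
exists (NConn b args i :: l0); first exact: path_app.
exact: branch_sim_cons (node_sim_App _ h) h1.
Qed.

Lemma tree_sim_subst p u b s : vars u = [::] -> tree_sim b s (subst p u s).
Proof.
move=> u0; elim: s b => [q|n|n|||s IHs t IHt|s IHs t IHt|k args IH] b /=;
  try exact: tree_sim_refl.
- case: ifP => _; last exact: tree_sim_refl.
  by apply: tree_sim_leaf => c r /socc_in_vars; rewrite u0.
- exact: tree_sim_Meet.
- exact: tree_sim_Join.
- by apply: tree_sim_App => j; apply: IH.
Qed.

(** A skeleton node is never PIA, so on either side being inductive reduces to the common tail
    [l]. *)
Lemma branch_sim_skeleton x y x' y' l :
  is_skeleton x -> is_skeleton y -> is_skeleton x' -> is_skeleton y' ->
  branch_sim (x :: y :: l) (x' :: y' :: l).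
Proof.
move=> sx sy sx' sy' p.
have nP z l0 : is_skeleton z -> ~ PIA_branch p (z :: l0).
  by move=> sz [/PIA_not_skeleton]; rewrite sz.
split=> [/nP//|[[_ [[_ h]|/nP//]]|/nP//]].
by left; split=> //; left.
Qed.

Lemma branch_sim_skeleton_dup x x' y' l :
  is_skeleton x -> is_skeleton x' -> is_skeleton y' ->
  branch_sim (x :: l) (x' :: y' :: l).
Proof.
move=> sx sx' sy' p.
have nP z l0 : is_skeleton z -> ~ PIA_branch p (z :: l0).
  by move=> sz [/PIA_not_skeleton]; rewrite sz.
split=> [/nP//|[[_ h]|/nP//]].
by left; split=> //; left.
Qed.

(** A branch through the distributed coordinate sees an SLR node and a Delta-adjoint change places;
    a branch through another coordinate gains a Delta-adjoint at the top. Both changes stay inside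
    the skeleton part. *)
Lemma tree_sim_distribute b s t : distribute b s t -> tree_sim b s t.
Proof.
elim=> {b s t}.
- move=> f args i s t Ei.
  have sk (a : 'I_(arity (CF f)) -> term L) (j : 'I_(arity (CF f))) :
      is_skeleton (NConn true a j).
    by rewrite /is_skeleton /= (leq_ltn_trans (leq0n j) (ltn_ord j)).
  suff key v l c q : (v = s \/ v = t) ->
      path_to true (App (update args i v)) l c (Var q) ->
      exists2 l0, path_to true (App args) l0 c (Var q) &
        branch_sim l0 (NJoin true :: l).
    by move=> l c q /path_inv[[]//|[l' [-> []]]] => /key; apply; [left|right].
  move=> hv /path_inv[[]//|[j [l' [-> h]]]].
  move: h; rewrite /update; case: eqP => [->|_] h; last first.
    exists (NConn true args j :: l'); first exact: path_app.
    exact: branch_sim_skeleton_dup.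
  (* [d] is the Delta-adjoint that the step moves above the connective. *)
  have [d [sd hd]] : exists d, is_skeleton d /\
      path_to (child_sign true i) (args i) (d :: l') c (Var q).
    rewrite Ei; move: h; rewrite /child_sign; case: ifP => _ h.
      exists (NJoin true); split=> //.
      by case: hv h => -> h; [apply: path_joinl | apply: path_joinr].
    exists (NMeet false); split=> //.
    by case: hv h => -> h; [apply: path_meetl | apply: path_meetr].
  exists (NConn true args i :: d :: l'); first exact: path_app.
  exact: branch_sim_skeleton.
- move=> g args i s t Ei.
  have sk (a : 'I_(arity (CG g)) -> term L) (j : 'I_(arity (CG g))) :
      is_skeleton (NConn false a j).
    by rewrite /is_skeleton /= (leq_ltn_trans (leq0n j) (ltn_ord j)).
  suff key v l c q : (v = s \/ v = t) ->
      path_to false (App (update args i v)) l c (Var q) ->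
      exists2 l0, path_to false (App args) l0 c (Var q) &
        branch_sim l0 (NMeet false :: l).
    by move=> l c q /path_inv[[]//|[l' [-> []]]] => /key; apply; [left|right].
  move=> hv /path_inv[[]//|[j [l' [-> h]]]].
  move: h; rewrite /update; case: eqP => [->|_] h; last first.
    exists (NConn false args j :: l'); first exact: path_app.
    exact: branch_sim_skeleton_dup.
  have [d [sd hd]] : exists d, is_skeleton d /\
      path_to (child_sign false i) (args i) (d :: l') c (Var q).
    rewrite Ei; move: h; rewrite /child_sign; case: ifP => _ h.
      exists (NMeet false); split=> //.
      by case: hv h => -> h; [apply: path_meetl | apply: path_meetr].
    exists (NJoin true); split=> //.
    by case: hv h => -> h; [apply: path_joinl | apply: path_joinr].
  exists (NConn false args i :: d :: l'); first exact: path_app.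
  exact: branch_sim_skeleton.
- by move=> b s s' t _ h; apply: tree_sim_Meet => //; apply: tree_sim_refl.
- by move=> b s t t' _ h; apply: tree_sim_Meet => //; apply: tree_sim_refl.
- by move=> b s s' t _ h; apply: tree_sim_Join => //; apply: tree_sim_refl.
- by move=> b s t t' _ h; apply: tree_sim_Join => //; apply: tree_sim_refl.
- move=> b k args i s' _ h; apply: tree_sim_App => j; rewrite /update.
  by case: eqP => [->|_] //; apply: tree_sim_refl.
Qed.

(** * Subtrees of inductive trees *)

Lemma inductive_tree_Meet s t :
  inductive_tree Omega e false (Meet s t) ->
  inductive_tree Omega e false s /\ inductive_tree Omega e false t.
Proof.
move=> /inductive_treeE h; split; apply/inductive_treeE => p l hl.
- by case: (h p (NMeet false :: l) (path_meetl _ hl)) => [[]|[/PIA_not_skeleton]].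
- by case: (h p (NMeet false :: l) (path_meetr _ hl)) => [[]|[/PIA_not_skeleton]].
Qed.

Lemma inductive_tree_Join s t :
  inductive_tree Omega e true (Join s t) ->
  inductive_tree Omega e true s /\ inductive_tree Omega e true t.
Proof.
move=> /inductive_treeE h; split; apply/inductive_treeE => p l hl.
- by case: (h p (NJoin true :: l) (path_joinl _ hl)) => [[]|[/PIA_not_skeleton]].
- by case: (h p (NJoin true :: l) (path_joinr _ hl)) => [[]|[/PIA_not_skeleton]].
Qed.

Lemma inductive_tree_SLR b k (args : 'I_(arity k) -> term L) i :
  SLR_conn b k -> inductive_tree Omega e b (App args) ->
  inductive_tree Omega e (child_sign b i) (args i).
Proof.
move=> hk /inductive_treeE h; apply/inductive_treeE => p l hl.
have sk : is_skeleton (NConn b args i) by rewrite /is_skeleton /= hk.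
case: (h p (NConn b args i :: l) (path_app hl)) => [[]|[/PIA_not_skeleton]] //.
by rewrite sk.
Qed.

Definition PIA_tree b s :=
  forall p l, path_to b s l (e p) (Var p) -> PIA_branch p l.

Definition Delta_root b s : bool :=
  match s with Meet _ _ => ~~ b | Join _ _ => b | _ => false end.

(** Every nonempty branch starts at the root; if the root is not a skeleton node, the skeleton part
    of a good branch is empty. *)
Lemma inductive_tree_PIA b s : ~~ SLR_root b s -> ~~ Delta_root b s ->
  inductive_tree Omega e b s -> PIA_tree b s.
Proof.
move=> nS nD /inductive_treeE h p l hl; have := h p l hl.
case: l hl => // x l hl [[sx _]|] //.
suff: is_skeleton x = false by rewrite sx.
case/path_inv: hl => [[]//|]; rewrite /is_skeleton.
case: s nS nD {h} => // [s t|s t|k args] /= nS nD.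
- by case=> l' [[-> _] _] /=; apply/negbTE; rewrite orbF.
- by case=> l' [[-> _] _] /=; apply/negbTE; rewrite orbF.
- by case=> i [l' [[-> _] _]] /=; apply/negbTE.
Qed.

End Inductive.

(** * Termination of preprocessing *)

(** [M n] joins an invariant to the value [n] of a decreasing measure, so that termination and
    preservation come from one induction. *)
Lemma exhaustively_measure (T : Type) (R : T -> T -> Prop) (M : nat -> T -> Prop) :
  (forall n x y, M n x -> R x y -> exists2 k, k < n & M k y) ->
  forall n x, M n x -> exists2 y, exhaustively R x y & exists k, M k y.
Proof.
move=> MR; elim/ltn_ind => n IH x Mx.
case: (EM (exists z, R x z)) => [[z xz]|nz]; last first.
  by exists x; [split=> //; apply: rt1n_refl | exists n].
have [k kn Mz] := MR _ _ _ Mx xz; have [y [zy ny] My] := IH k kn z Mz.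
by exists y => //; split=> //; apply: rt1n_trans zy.
Qed.

Lemma update_id (T : Type) n (F : 'I_n -> T) i v : update F i v i = v.
Proof. by rewrite /update eqxx. Qed.

Lemma update_ne (T : Type) n (F : 'I_n -> T) i v j :
  j != i -> update F i v j = F j.
Proof. by rewrite /update => /negbTE->. Qed.

Section Preprocessing.
Variables (L : LE_language) (Omega : PROP L -> PROP L -> Prop).
Variable e : PROP L -> bool.
Implicit Types (s t u : term L) (b : bool) (p q : PROP L).

(** * Elimination of variables of uniform polarity, and distribution *)

Lemma in_LE_subst p u s : in_LE u -> in_LE s -> in_LE (subst p u s).
Proof.
move=> hu; elim: s => [q|n|n|||s IHs t IHt|s IHs t IHt|k args IH] //=.
- by case: ifP.
- by case=> /IHs ? /IHt.
- by case=> /IHs ? /IHt.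
- by case: k args IH => //= f args IH h i; apply: IH.
Qed.

Lemma in_LE_distribute b s t : distribute b s t -> in_LE s -> in_LE t.
Proof.
elim=> {b s t} /=.
- move=> f args i s t Ei h; have : in_LE s /\ in_LE t.
    by move: (h i); rewrite Ei; case: ifP.
  by move=> [hs ht]; split=> j; rewrite /update; case: eqP.
- move=> g args i s t Ei h; have : in_LE s /\ in_LE t.
    by move: (h i); rewrite Ei; case: ifP.
  by move=> [hs ht]; split=> j; rewrite /update; case: eqP.
- by move=> b s s' t _ IH [/IH].
- by move=> b s s' t _ IH [? /IH].
- by move=> b s s' t _ IH [/IH].
- by move=> b s s' t _ IH [? /IH].
- move=> b [f|g|f j|g j] args i s' _ IH //= h m; rewrite /update;
    by case: eqP => // _; apply/IH/h.
Qed.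

(** The number of variable occurrences drops, since the eliminated variable does occur and is
    replaced by a constant. *)
Lemma eliminate_exhaustively (a : ineq L) :
  in_LE_ineq a -> inductive_ineq_for Omega e a ->
  exists2 a', exhaustively (@eliminate L) a a' &
    in_LE_ineq a' /\ inductive_ineq_for Omega e a'.
Proof.
pose M n (a : ineq L) := [/\ in_LE_ineq a, inductive_ineq_for Omega e a &
  size (vars (lhs a)) + size (vars (rhs a)) = n].
move=> hLE hind.
case: (@exhaustively_measure _ (@eliminate L) M _ _ a (And3 hLE hind erefl))
  => [|a' ex [k [h1 h2 _]]]; last by exists a'.
have key n p u s t : vars u = [::] -> in_LE u -> occurs_ineq (Var p) (Leq s t) ->
    M n (Leq s t) -> exists2 k, k < n & M k (Leq (subst p u s) (subst p u t)).
  move=> u0 uLE oc [[/= sLE tLE] [/= si ti] <-].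
  exists (size (vars (subst p u s)) + size (vars (subst p u t))).
    have Es := size_vars_subst p u s; have Et := size_vars_subst p u t.
    rewrite u0 /= !muln0 !addn0 in Es Et; rewrite -Es -Et addnACA -[X in X < _]addn0.
    rewrite ltn_add2l lt0n addn_eq0 !occ_eq0 -negb_or negbK.
    by case: oc => /= /in_varsP-> //; rewrite orbT.
  split=> //; split=> /=; try exact: in_LE_subst.
  - exact: tree_sim_inductive (tree_sim_subst _ _ u0) si.
  - exact: tree_sim_inductive (tree_sim_subst _ _ u0) ti.
move=> n x y Mx xy; case: xy Mx => p s t oc _ _ Mx; exact: key.
Qed.

(* The factor 2 pays for the join or meet that distribution creates outside. *)
Fixpoint dweight s : nat :=
  match s with
  | Meet t u | Join t u => dweight t + dweight u + 1
  | App k args => 2 * \prod_(i < arity k) dweight (args i)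
  | _ => 1
  end.

Lemma dweight_gt0 s : 0 < dweight s.
Proof.
elim: s => [q|n|n|||s IHs t IHt|s IHs t IHt|k args IH] //=.
- by rewrite addn1.
- by rewrite addn1.
- by rewrite muln_gt0 /=; apply: prodn_gt0.
Qed.

Lemma dweight_update k (args : 'I_(arity k) -> term L) i v :
  dweight (App (update args i v)) =
  dweight v * (2 * \prod_(j < arity k | j != i) dweight (args j)).
Proof.
rewrite /= (bigD1 i) //= update_id mulnCA; congr (_ * (_ * _)).
by apply: eq_bigr => j ji; rewrite update_ne.
Qed.

Lemma dweight_args k (args : 'I_(arity k) -> term L) i :
  dweight (App args) =
  dweight (args i) * (2 * \prod_(j < arity k | j != i) dweight (args j)).
Proof. by rewrite /= (bigD1 i) //= mulnCA. Qed.

(** Let [P] be the product of the weights of the other arguments, and [x], [y] the weights of the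
    two parts. A step at the root replaces [2 (x + y + 1) P] by [2 x P + 2 y P + 1], which is
    smaller as [P] is positive. *)
Lemma dweight_distribute b s t : distribute b s t -> dweight t < dweight s.
Proof.
have pos k (args : 'I_(arity k) -> term L) (i : 'I_(arity k)) :
    0 < \prod_(j < arity k | j != i) dweight (args j).
  by apply: prodn_cond_gt0 => j _; apply: dweight_gt0.
have key k (args : 'I_(arity k) -> term L) i s' t' :
    dweight (args i) = dweight s' + dweight t' + 1 ->
    dweight (App (update args i s')) + dweight (App (update args i t')) + 1 <
    dweight (App args).
  move=> E; rewrite !dweight_update (dweight_args args i) E !mulnDl.
  by rewrite mul1n ltn_add2l leq_pmulr.
elim=> {b s t}.
- by move=> f args i s t Ei; apply: key; rewrite Ei; case: ifP.
- by move=> f args i s t Ei; apply: key; rewrite Ei; case: ifP.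
- by move=> b s s' t _ h /=; rewrite !ltn_add2r.
- by move=> b s s' t _ h /=; rewrite ltn_add2r ltn_add2l.
- by move=> b s s' t _ h /=; rewrite !ltn_add2r.
- by move=> b s s' t _ h /=; rewrite ltn_add2r ltn_add2l.
- move=> b k args i s' _ h; rewrite dweight_update (dweight_args args i).
  by rewrite ltn_pmul2r // muln_gt0 pos.
Qed.

Lemma distribute_exhaustively (a : ineq L) :
  in_LE_ineq a -> inductive_ineq_for Omega e a ->
  exists2 a', exhaustively (@distribute_ineq L) a a' &
    in_LE_ineq a' /\ inductive_ineq_for Omega e a'.
Proof.
pose M n (a : ineq L) := [/\ in_LE_ineq a, inductive_ineq_for Omega e a &
  dweight (lhs a) + dweight (rhs a) = n].
move=> hLE hind.
case: (@exhaustively_measure _ (@distribute_ineq L) M _ _ a (And3 hLE hind erefl))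
  => [|a' ex [k [h1 h2 _]]]; last by exists a'.
move=> n x y Mx xy; case: xy Mx => s s' t d [[/= sLE tLE] [/= si ti] <-].
- exists (dweight s' + dweight t); first by rewrite ltn_add2r (dweight_distribute d).
  split=> //; first by split=> //; apply: (in_LE_distribute d).
  split=> //; exact: tree_sim_inductive (tree_sim_distribute Omega e d) si.
- exists (dweight s + dweight t); first by rewrite ltn_add2l (dweight_distribute d).
  split=> //; first by split=> //; apply: (in_LE_distribute d).
  split=> //; exact: tree_sim_inductive (tree_sim_distribute Omega e d) ti.
Qed.

(** * Finite sets given by lists, and splitting *)

Definition set_of (r : seq (ineq L)) : set (ineq L) := fun a => List.In a r.

Lemma set_of_cat r1 r2 : set_of (r1 ++ r2) = set_of r1 `|` set_of r2.
Proof.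
by apply/seteqP; split=> a /List.in_app_iff.
Qed.

Lemma set2_of (a b : ineq L) : [set a; b] = set_of [:: a; b].
Proof.
apply/seteqP; split=> c /=.
  by case=> ->; [left | right; left].
by case=> [->|[->|//]]; [left | right].
Qed.

(** Carries a replacement in a set over to lists, where weights can be summed. [f] is the identity
    for splitting, and [ineq_of] for decomposition, whose entries record more than the
    inequality. *)
Lemma replace_listed (T : Type) (f : T -> ineq L) (w : T -> nat) (r B : seq T) x :
  List.In x r -> \sum_(y <- B) w y < w x ->
  exists r', [/\ replace_in (set_of (map f r)) (f x) (set_of (map f B)) =
                 set_of (map f r'),
    forall y, List.In y r' -> List.In y r \/ List.In y B &
    \sum_(y <- r') w y < \sum_(y <- r) w y].
Proof.
(* Deleting [f x] from the set deletes every entry with that image, not only [x]. *)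
move=> xr wB; pose r0 := [seq y <- r | ~~ `[< f y = f x >]].
have in_r0 y : List.In y r0 <-> List.In y r /\ f y <> f x.
  rewrite /r0; elim: (r) => [|z r1 IH] /=; first by intuition.
  case: asboolP => h /=; split.
  - by case/IH; intuition.
  - by case=> [[<-//|? ?]]; apply/IH.
  - by case=> [<-|/IH]; intuition.
  - by case=> [[<-|? ?]]; [left | right; apply/IH].
have inf y l : List.In y (map f l) <-> exists2 z, f z = y & List.In z l.
  split=> [/List.in_map_iff[z [E h]]|[z E h]]; first by exists z.
  by apply/List.in_map_iff; exists z.
exists (r0 ++ B); split.
- rewrite map_cat set_of_cat /replace_in; congr (_ `|` _).
  apply/seteqP; split=> a; rewrite /set_of /=.
    case=> /inf[z <- zr] ne; apply/inf; exists z => //.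
    by apply/in_r0; split=> // E; apply: ne; rewrite /set1 /= E.
  by case/inf=> z <- /in_r0[zr ne]; split=> //; apply/inf; exists z.
- by move=> y /List.in_app_iff[/in_r0[]|]; [left | right].
- rewrite big_cat /=; apply: (@leq_trans (\sum_(y <- r0) w y + w x)).
    by rewrite ltn_add2l.
  rewrite /r0; elim: r xr {r0 in_r0} => //= y r IH yr; rewrite big_cons.
  have le0 : forall l, \sum_(z <- [seq z <- l | ~~ `[< f z = f x >]]) w z
      <= \sum_(z <- l) w z.
    elim=> [|z l IHl] /=; first by rewrite big_nil.
    case: ifP => _; rewrite !big_cons ?leq_add2l //.
    exact: leq_trans IHl (leq_addl _ _).
  case: yr => [->|/IH le].
    by rewrite (introT (asboolP _) erefl) /= addnC leq_add2l.
  case: ifP => _; rewrite ?big_cons -?addnA ?leq_add2l //.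
  exact: leq_trans le (leq_addl _ _).
Qed.

Fixpoint tsize s : nat :=
  match s with
  | Meet t u | Join t u => (tsize t + tsize u).+1
  | App k args => (\sum_(i < arity k) tsize (args i)).+1
  | _ => 1
  end.

Lemma tsize_gt0 s : 0 < tsize s.
Proof. by case: s. Qed.

Definition prepared b s := [/\ in_LE s, inductive_tree Omega e b s &
  forall t, ~ distribute b s t].

Lemma prepared_Meet s t :
  prepared false (Meet s t) -> prepared false s /\ prepared false t.
Proof.
case=> -[sLE tLE] /inductive_tree_Meet[si ti] nd; split; split=> // u d.
- exact: nd (distribute_meetl _ d).
- exact: nd (distribute_meetr _ d).
Qed.

Lemma prepared_Join s t :
  prepared true (Join s t) -> prepared true s /\ prepared true t.
Proof.
case=> -[sLE tLE] /inductive_tree_Join[si ti] nd; split; split=> // u d.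
- exact: nd (distribute_joinl _ d).
- exact: nd (distribute_joinr _ d).
Qed.

Lemma splitting_exhaustively (a : ineq L) :
  prepared true (lhs a) -> prepared false (rhs a) ->
  exists2 S, exhaustively (@splitting L) [set a] S &
    forall c, S c ->
      [/\ prepared true (lhs c), ~~ Delta_root true (lhs c),
          prepared false (rhs c) & ~~ Delta_root false (rhs c)].
Proof.
(* Splitting copies the other side, so a sum of sizes need not drop. The product does: it is
   distributed over the two parts, and the size of the split node itself is lost. *)
pose w (c : ineq L) := tsize (lhs c) * tsize (rhs c).
pose ok (c : ineq L) := prepared true (lhs c) /\ prepared false (rhs c).
pose M n (S : set (ineq L)) := exists r, [/\ S = set_of r,
  forall c, List.In c r -> ok c & \sum_(c <- r) w c = n].
move=> ha1 ha2.
have M0 : M (\sum_(c <- [:: a]) w c) [set a].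
  exists [:: a]; split=> [|c [<-|//]|] //.
  by apply/seteqP; split=> c /=; [move=> ->; left | case=> [->|]].
case: (@exhaustively_measure _ (@splitting L) M _ _ _ M0) => [n S S' [r [-> okr <-]] sp|S ex [n [r [ES okr _]]]].
  have key x B : List.In x r -> (ok x -> forall c, List.In c B -> ok c) ->
      \sum_(y <- B) w y < w x ->
      exists2 k, k < \sum_(c <- r) w c &
        M k (replace_in (set_of r) x (set_of B)).
    move=> xr okB wB; have [r' [E sub lt]] := replace_listed id xr wB.
    rewrite !map_id in E; rewrite E; exists (\sum_(y <- r') w y) => //.
    by exists r'; split=> // c /sub[/okr//|]; apply/okB/okr.
  case: {-2}_ _ / sp (erefl (set_of r)) => S0 s t u Sst E; rewrite E in Sst *;
    rewrite set2_of; apply: key => //.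
  - case=> /= hs /prepared_Meet[ht hu] c [<-|[<-|//]] //.
  - rewrite big_cons big_seq1 /w /= -mulnDr ltn_mul2l tsize_gt0 /=.
    exact: ltnSn.
  - case=> /= /prepared_Join[ht hu] hs c [<-|[<-|//]] //.
  - rewrite big_cons big_seq1 /w /= -mulnDl ltn_mul2r tsize_gt0 /=.
    exact: ltnSn.
exists S => // c Sc; case: ex => _ nS.
have [h1 h2] : ok c by apply: okr; move: Sc; rewrite ES.
split=> //.
- case: c Sc {h1 h2} => s t Sc; case: s Sc => //= s u Sc.
  by case: nS; eexists; apply: split_join Sc.
- case: c Sc {h1 h2} => s t Sc; case: t Sc => //= t u Sc.
  by case: nS; eexists; apply: split_meet Sc.
Qed.

End Preprocessing.

(** * Reduction and elimination *)

Section Runs.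
Variables (L : LE_language) (Omega : PROP L -> PROP L -> Prop).
Variable e : PROP L -> bool.
Hypothesis Omega_irr : forall p, ~ Omega p p.
Hypothesis Omega_trans : forall p q r, Omega p q -> Omega q r -> Omega p r.
Implicit Types (s t u : term L) (b : bool) (p q : PROP L).

Definition reaches (Q Q' : system L) := exists tr,
  [/\ is_run Q tr, final_system Q tr = Q' &
      all (fun step => pivotal_rule step.1) tr].

Lemma reaches_refl Q : reaches Q Q.
Proof. by exists [::]. Qed.

Lemma reaches_step r Q Q' Q'' :
  apply_rule r Q Q' -> pivotal_rule r -> reaches Q' Q'' -> reaches Q Q''.
Proof.
move=> h hr [tr [h1 h2 h3]]; exists ((r, Q') :: tr); split=> //=.
by rewrite hr.
Qed.

Lemma reaches_trans Q Q' Q'' : reaches Q Q' -> reaches Q' Q'' -> reaches Q Q''.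
Proof.
move=> [tr [h1 <- h3]]; elim: tr Q h1 h3 => [|[r Q1] tr IH] Q //=.
by move=> [h1 h2] /andP[hr h3] /(IH _ h2 h3); apply: reaches_step h1 hr.
Qed.

(** * Approximation at the ends of maximal SLR branches *)

Definition PIA_leaf b s := ~ pure s -> in_LE s /\ PIA_tree Omega e b s.

(** The leaves are where pivotal approximation acts. [PIA_leaf] constrains impure leaves only, so a
    name put in place of a leaf, though outside the original language, leaves a [skel] tree. *)
Inductive skel : bool -> term L -> Prop :=
| skel_SLR b k (args : 'I_(arity k) -> term L) : SLR_conn b k ->
    (forall i, skel (child_sign b i) (args i)) -> skel b (App args)
| skel_leaf b s : ~~ SLR_root b s -> PIA_leaf b s -> skel b s.

(* A Delta-adjoint below an SLR node could be distributed over. *)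
Lemma Delta_child_distribute b k (args : 'I_(arity k) -> term L) i :
  SLR_conn b k -> Delta_root (child_sign b i) (args i) ->
  exists t, distribute b (App args) t.
Proof.
case: k args i => [f|g|//|//] args i /=.
- case: b => // _; rewrite /child_sign => hD.
  suff [s [t Ei]] : exists s t, args i = if order_type i then Join s t else Meet s t.
    by eexists; apply: distribute_F Ei.
  by case: ifP hD => _; case: (args i) => //= s t _; exists s, t.
- case: b => // _; rewrite /child_sign => hD.
  suff [s [t Ei]] : exists s t, args i = if order_type i then Meet s t else Join s t.
    by eexists; apply: distribute_G Ei.
  by case: ifP hD => _; case: (args i) => //= s t _; exists s, t.
Qed.

(** Descending through SLR nodes never meets a Delta-adjoint, as it could be distributed over; where
    the descent stops, critical branches are PIA. *)
Lemma prepared_skel b s : prepared Omega e b s -> ~~ Delta_root b s -> skel b s.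
Proof.
elim: s b => [q|n|n|||s IHs t IHt|s IHs t IHt|k args IH] b hs hD;
  try by apply: skel_leaf => // _; case: hs => sLE si _; split=> //;
         apply: inductive_tree_PIA si.
have [hk|hk] := boolP (SLR_conn b k); last first.
  apply: skel_leaf => // _; case: hs => sLE si _; split=> //.
  exact: inductive_tree_PIA si.
case: hs => sLE si nd; apply: skel_SLR => // i; apply: IH.
- split.
  + by case: (k) (args) (i) sLE hk => [f|g|f j|g j] //=; case: (b).
  + exact: inductive_tree_SLR si.
  + by move=> t d; apply: (nd (App (update args i t))); apply: distribute_app.
- by apply/negP => /(Delta_child_distribute hk)[t]; apply: nd.
Qed.

Lemma App_update k (args : 'I_(arity k) -> term L) i t : args i = t ->
  App (update args i t) = App args.
Proof.
move=> E; congr App; apply: funext => j; rewrite /update.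
by case: eqP => // ->.
Qed.

Lemma subst_App_update x t k (args : 'I_(arity k) -> term L) i s0 :
  x \notin vars (App args) ->
  subst x t (App (update args i s0)) = App (update args i (subst x t s0)).
Proof.
move=> /= /mem_bigcat xs; congr App; apply: funext => j; rewrite /update.
case: eqP => // _; apply: subst_notin.
by apply/negP => h; apply: xs; exists j.
Qed.

(** Selects one impure leaf [t]; freshness of [x] makes its occurrence in the context [s0] unique.
    The last clause allows extraction to be repeated. *)
Lemma skel_extract b s x : skel b s -> ~ pure s -> x \notin vars s ->
  exists s0 t c l,
    [/\ s = subst x t s0, occ x s0 = 1, path_to b s0 l c (Var x) & SLR_branch l] /\
    [/\ ~~ SLR_root c t, in_LE t, PIA_tree Omega e c t, ~ pure t &
        forall n, skel b (subst x (name L c n) s0)].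
Proof.
elim=> {b s} [b k args hk hargs IH|b s nS leaf] np xs; last first.
  have [sLE sP] := leaf np.
  exists (Var x), s, b, [::]; rewrite /= eqxx; split; split=> //.
    by constructor.
  move=> n; apply: skel_leaf; first by case: (b).
  by case=> q /in_varsP; case: (b).
have [i npi] : exists i, ~ pure (args i).
  apply/not_existsP => h; apply: np => q /in_varsP/mem_bigcat[i /in_varsP].
  by have /contrapT := h i; apply.
have xnot j : x \notin vars (args j).
  by apply/negP => hj; move/negP: xs; apply; apply/mem_bigcat; exists j.
have [s0 [t [c [l [[E o1 pth br] [h1 h2 h3 h4 h5]]]]]] := IH i npi (xnot i).
exists (App (update args i s0)), t, c, (NConn b (update args i s0) i :: l).
split; split=> //.
- by rewrite subst_App_update // -E App_update.
- rewrite /= (bigD1 i) //= update_id o1 big1 ?addn0 // => j ji.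
  by rewrite update_ne //; apply/eqP; rewrite occ_eq0.
- by apply: path_app; rewrite update_id.
- by rewrite /= hk.
- move=> n; rewrite subst_App_update //; apply: skel_SLR => // j.
  by rewrite /update; case: eqP => [->|_].
Qed.

Lemma vars_name c n : vars (name L c n) = [::].
Proof. by case: c. Qed.

Lemma size_vars_extract x t s0 c n : occ x s0 = 1 -> ~ pure t ->
  size (vars (subst x (name L c n) s0)) < size (vars (subst x t s0)).
Proof.
move=> o1 np; have E1 := size_vars_subst x (name L c n) s0.
have E2 := size_vars_subst x t s0.
rewrite o1 vars_name addn0 addn1 in E1; rewrite o1 mul1n addn1 in E2.
rewrite E1 -ltnS E2 -[X in X < _]addn0 ltn_add2l lt0n.
by apply/eqP => /size0nil/pureP.
Qed.

(** A term has finitely many nodes, hence a bound on its name indices; this makes a least fresh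
    index available. *)
Lemma names_bounded s : exists N, forall b n, N <= n ->
  forall b' l c, ~ path_to b' s l c (name L b n).
Proof.
have leaf t b n b' l c : path_to b' t l c (name L b n) ->
    match t with Meet _ _ | Join _ _ | App _ _ => True | _ => name L b n = t end.
  by case/path_inv => [[_ _ ->]|]; case: t => // *; case: b.
have node t : (if t is Meet _ _ then true else if t is Join _ _ then true else
      if t is App _ _ then true else false) ->
    forall b n b' l c, path_to b' t l c (name L b n) ->
    match t with
    | Meet t v | Join t v => exists l', path_to b' t l' c (name L b n) \/
         path_to b' v l' c (name L b n)
    | App k args => exists i l', path_to (child_sign b' i) (args i) l' c (name L b n)
    | _ => False end.
  move=> ht b n b' l c /path_inv[[_ _ E]|]; first by case: t ht E; case: b.
  by case: t ht => // [t v|t v|k args] _ => [[l' [_ h]]|[l' [_ h]]|[i [l' [_ h]]]];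
    [exists l'|exists l'|exists i, l'].
elim: s => [q|m|m|||s [N hs] t [M ht]|s [N hs] t [M ht]|k args IH].
- by exists 0 => b n _ b' l c /leaf; case: b.
- by exists m.+1 => b n h b' l c /leaf; case: b => // -[E]; rewrite E ltnn in h.
- by exists m.+1 => b n h b' l c /leaf; case: b => // -[E]; rewrite E ltnn in h.
- by exists 0 => b n _ b' l c /leaf; case: b.
- by exists 0 => b n _ b' l c /leaf; case: b.
- exists (maxn N M) => b n; rewrite geq_max => /andP[hN hM] b' l c.
  by move=> /node[]// l' []; [apply: hs|apply: ht].
- exists (maxn N M) => b n; rewrite geq_max => /andP[hN hM] b' l c.
  by move=> /node[]// l' []; [apply: hs|apply: ht].
- have [N hN] := choice IH; exists (\max_i N i) => b n h b' l c /node[]// i [l'].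
  by apply: hN; apply: leq_trans h; apply: leq_bigmax.
Qed.

Lemma first_fresh_exists b (r : seq (ineq L)) (a : ineq L) :
  exists n, first_fresh b n (set_of r, a).
Proof.
have bound (c : ineq L) : exists N, forall n, N <= n -> ~ occurs_ineq (name L b n) c.
  have [N hN] := names_bounded (lhs c); have [M hM] := names_bounded (rhs c).
  exists (maxn N M) => n; rewrite geq_max => /andP[nN nM] [[l [d]]|[l [d]]].
    exact: hN.
  exact: hM.
have [N hN] : exists N, forall n, N <= n -> ~ occurs_system (name L b n) (set_of r, a).
  have [M hM] := bound a; elim: r => [|c r [N hN]].
    by exists M => n hn [[]//|/=]; apply: hM.
  have [K hK] := bound c; exists (maxn N K) => n; rewrite geq_max => /andP[nN nK].
  case=> [[d [<-|dr]] /=|/= ha]; first exact: hK.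
    by move=> hd; apply: (hN n nN); left; exists d.
  by apply: (hN n nN); right.
have ex : exists n, `[< ~ occurs_system (name L b n) (set_of r, a) >].
  by exists N; apply/asboolP/hN.
case: (ex_minnP ex) => n /asboolP nn min; exists n; split=> // k kn.
apply: contrapT => h; have /min : `[< ~ occurs_system (name L b k) (set_of r, a) >].
  exact/asboolP.
by rewrite leqNgt kn.
Qed.

(** * The invariant of the extracted inequalities *)

Definition noncritical b s := forall c p, signed_occ b s c p -> c = ~~ e p.

(** In the set part of a system the signs of the two sides are opposite to those of the main
    inequality: an extracted term keeps its sign, which is + to the right of a nominal and - to the
    left of a co-nominal. *)
Definition noncritical_ineq (a : ineq L) :=
  noncritical false (lhs a) /\ noncritical true (rhs a).

Lemma noncritical_agrees b s : noncritical b s <-> agrees (dual_order e) b s.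
Proof. by split=> [h|/agreesE//]; apply/agreesE. Qed.

Definition sided b s t : ineq L := if b then Leq s t else Leq t s.

(* In [(b, s, t)] the term [t], of sign [b], is still to be decomposed and [s],
   of opposite sign, holds the side arguments displaced by residuation. *)
Definition ineq_of (x : bool * term L * term L) := sided x.1.1 x.1.2 x.2.

(** The first two clauses are what makes the displaced side an admissible bound once the other side
    has shrunk to a critical variable. *)
Definition decomposable (x : bool * term L * term L) :=
  [/\ noncritical (~~ x.1.1) x.1.2,
      forall q p, q \in vars x.1.2 -> signed_occ x.1.1 x.2 (e p) p -> Omega q p &
      PIA_tree Omega e x.1.1 x.2].

Lemma name_ineqE b n t : name_ineq b n t = ineq_of (b, name L b n, t).
Proof. by case: b. Qed.

Lemma decomposable_name b n t :
  PIA_tree Omega e b t -> decomposable (b, name L b n, t).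
Proof.
by move=> h; split=> //= [c p /socc_name|q p]; rewrite ?vars_name.
Qed.

(** Each extraction replaces an impure leaf by a name, lowering the number of variable occurrences
    in the main inequality. *)
Lemma approximate_all (r : seq (bool * term L * term L)) (a : ineq L) :
  (forall x, List.In x r -> decomposable x) ->
  skel true (lhs a) -> skel false (rhs a) ->
  exists r' a', [/\ reaches (set_of (map ineq_of r), a) (set_of (map ineq_of r'), a'),
    forall x, List.In x r' -> decomposable x & pure_ineq a'].
Proof.
have [n] := ubnP (size (vars (lhs a)) + size (vars (rhs a))).
elim: n r a => // n IH r [s t] /= hn hr ss st.
have add c k v : set_of (map ineq_of r) `|` [set name_ineq c k v] =
    set_of (map ineq_of (rcons r (c, name L c k, v))).
  rewrite map_rcons -cats1 set_of_cat name_ineqE; congr (_ `|` _).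
  by apply/seteqP; split=> d /=; [move=> ->; left | case=> [->|]].
have radd c k v : PIA_tree Omega e c v -> forall x,
    List.In x (rcons r (c, name L c k, v)) -> decomposable x.
  move=> vP x; rewrite -cats1 => /List.in_app_iff[/hr//|[<-|//]].
  exact: decomposable_name.
have [ps|nps] := EM (pure s); last first.
  have [x xs] := exists_fresh (vars s).
  have [s0 [v [c [l [[E o1 pth br] [h1 h2 h3 h4 h5]]]]]] := skel_extract ss nps xs.
  rewrite {nps}E in hn ss *.
  have [k fr] := first_fresh_exists c (map ineq_of r) (Leq (subst x v s0) t).
  have step := approximation_lhs h2 o1 pth br fr; rewrite add in step.
  case: (IH _ (Leq _ t) _ (radd c k v h3) (h5 k) st) => [|r' [a' [ra h h']]].
    rewrite -ltnS; apply: leq_trans hn; rewrite ltnS /= ltn_add2r.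
    exact: size_vars_extract.
  by exists r', a'; split=> //; apply: (reaches_step (r := Approximation c v)) ra.
have [pt|npt] := EM (pure t).
  by exists r, (Leq s t); split=> //; apply: reaches_refl.
have [x xt] := exists_fresh (vars t).
have [t0 [v [c [l [[E o1 pth br] [h1 h2 h3 h4 h5]]]]]] := skel_extract st npt xt.
rewrite {npt}E in hn st *.
have [k fr] := first_fresh_exists c (map ineq_of r) (Leq s (subst x v t0)).
have step := approximation_rhs h2 o1 pth br fr; rewrite add in step.
case: (IH _ (Leq s _) _ (radd c k v h3) ss (h5 k)) => [|r' [a' [ra h h']]].
  rewrite -ltnS; apply: leq_trans hn; rewrite ltnS /= ltn_add2l.
  exact: size_vars_extract.
by exists r', a'; split=> //; apply: (reaches_step (r := Approximation c v)) ra.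
Qed.

(** * Decomposition along critical branches *)

Definition decomposed (x : bool * term L * term L) :=
  noncritical x.1.1 x.2 \/ exists2 p, x.2 = Var p & x.1.1 = e p.

(* The displaced side after residuating at [i]; only connectives of F and G are
   residuated, the value for the others is junk. *)
Definition residual_of (k : conn L) : 'I_(arity k) -> ('I_(arity k) -> term L) ->
    term L -> term L :=
  match k return 'I_(arity k) -> ('I_(arity k) -> term L) -> term L -> term L with
  | CF f => fun i args s => @App L (Sharp f i) (update args i s)
  | CG g => fun i args s => @App L (Flat g i) (update args i s)
  | _ => fun _ _ s => s
  end.

(** A PIA connective is a positive [g], standing on the right, or a negative [f], standing on the
    left: the positions where residuation applies. *)
Lemma residuate_PIA b k (args : 'I_(arity k) -> term L) i s :
  is_PIA (NConn b args i) ->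
  residuate (sided b s (App args))
    (sided (child_sign b i) (residual_of i args s) (args i)).
Proof.
rewrite /is_PIA /=; case: k args i => [f|g|f j|g j] args i //=.
- case: b => //= _; rewrite /child_sign /=.
  by case: ifP => o /=; [apply: residuate_F | apply: residuate_F_dual; rewrite o].
- case: b => //= _; rewrite /child_sign /=.
  by case: ifP => o /=; [apply: residuate_G | apply: residuate_G_dual; rewrite o].
Qed.

(** The order-type of a residual is such that every argument moved across the inequality, and [s]
    itself, keeps its sign. *)
Lemma socc_residual b k (args : 'I_(arity k) -> term L) i s c q :
  is_PIA (NConn b args i) ->
  signed_occ (~~ child_sign b i) (residual_of i args s) c q ->
  signed_occ (~~ b) s c q \/
  exists2 h, h != i & signed_occ (child_sign b h) (args h) c q.
Proof.
rewrite /is_PIA /=; case: k args i => [f|g|f j|g j] args i //= _.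
- case/socc_App => h; rewrite /update /child_sign /= /residual_order.
  case: (eqVneq h i) => [_|hi] /=.
    by case: (order_F i) => /=; rewrite ?negbK; left.
  move=> hh; right; exists h => //; move: hh.
  by case: (order_F i); case: (order_F h); rewrite /= ?negbK.
- case/socc_App => h; rewrite /update /child_sign /= /residual_order.
  case: (eqVneq h i) => [_|hi] /=.
    by case: (order_G i) => /=; rewrite ?negbK; left.
  move=> hh; right; exists h => //; move: hh.
  by case: (order_G i); case: (order_G h); rewrite /= ?negbK.
Qed.

Lemma vars_residual b k (args : 'I_(arity k) -> term L) i s q :
  is_PIA (NConn b args i) -> q \in vars (residual_of i args s) ->
  q \in vars s \/ exists2 h, h != i & q \in vars (args h).
Proof.
move=> hP /(in_vars_socc (~~ child_sign b i))[c] /(socc_residual hP)[|[h hi]].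
  by move/socc_in_vars; left.
by move/socc_in_vars; right; exists h.
Qed.

Lemma PIA_args b k (args : 'I_(arity k) -> term L) i p h :
  is_PIA (NConn b args i) ->
  (is_SRR (NConn b args i) -> side_condition Omega e p (NConn b args i)) ->
  h != i ->
  noncritical (child_sign b h) (args h) /\
  forall q, q \in vars (args h) -> Omega q p.
Proof.
move=> hP side hi.
(* An SRA connective is unary and has no coordinate other than [i]. *)
have SRR : is_SRR (NConn b args i).
  move: hP; rewrite /is_PIA /= => /orP[] // SRA.
  suff k1 : arity k = 1.
    have sub n (m m' : 'I_n) : n = 1 -> m = m' by move=> n1; subst n; rewrite !ord1.
    by rewrite (sub _ h i k1) eqxx in hi.
  by case: (k) SRA => //= f /andP[_ /eqP].
have [/noncritical_agrees nc oc] := side SRR h hi.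
by split=> // q /in_varsP; apply: oc.
Qed.

(** Some critical branch remains and starts with a PIA node: a positive meet or negative join is
    split, a connective is residuated at the coordinate the branch takes. *)
Lemma decompose_step x : decomposable x -> ~ decomposed x ->
  exists B, [/\ forall y, List.In y B -> decomposable y,
    \sum_(y <- B) tsize y.2 < tsize x.2 &
    forall Q a, Q (ineq_of x) -> exists2 r,
      apply_rule r (Q, a) (replace_in Q (ineq_of x) (set_of (map ineq_of B)), a) &
      pivotal_rule r].
Proof.
case: x => [[b s] t]; rewrite /decomposable /decomposed /ineq_of /=.
move=> [ncs sO tP] nd.
have [p [l hl]] : exists p, signed_occ b t (e p) p.
  apply/not_existsP => h; apply: nd; left => c p hc.
  by case: (eqVneq c (e p)) hc => [->/h//|]; case: c; case: (e p).
case: t nd sO tP hl => [q|n|n|||t u|t u|k args] nd sO tP hl.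
- case: nd; right; exists q => //.
  by case/path_inv: hl => [[_ <- [->]]|].
- by case/path_inv: hl => [[]|].
- by case/path_inv: hl => [[]|].
- by case/path_inv: hl => [[]|].
- by case/path_inv: hl => [[]|].
- have hb : b.
    have := tP p l hl; case/path_inv: hl => [[]//|[l' [-> _]]] [].
    by rewrite /is_PIA /= orbF.
  rewrite {}hb in ncs sO tP *.
  exists [:: (true, s, t); (true, s, u)]; split.
  + move=> y [<-|[<-|//]]; split=> //= [q p' qs hp'|p' l' hl'].
    * by apply: sO => //; apply/socc_Meet; left.
    * by case: (tP p' _ (path_meetl u hl')).
    * by apply: sO => //; apply/socc_Meet; right.
    * by case: (tP p' _ (path_meetr t hl')).
  + by rewrite big_cons big_seq1 /= ltnSn.
  + move=> Q a Qx; exists (@Splitting L) => //; split=> //=.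
    by rewrite -set2_of; apply: split_meet.
- have hb : b = false.
    have := tP p l hl; case/path_inv: hl => [[]//|[l' [-> _]]] [].
    by rewrite /is_PIA /= orbF => /negbTE.
  rewrite {}hb in ncs sO tP *.
  exists [:: (false, s, t); (false, s, u)]; split.
  + move=> y [<-|[<-|//]]; split=> //= [q p' qs hp'|p' l' hl'].
    * by apply: sO => //; apply/socc_Join; left.
    * by case: (tP p' _ (path_joinl u hl')).
    * by apply: sO => //; apply/socc_Join; right.
    * by case: (tP p' _ (path_joinr t hl')).
  + by rewrite big_cons big_seq1 /= ltnSn.
  + move=> Q a Qx; exists (@Splitting L) => //; split=> //=.
    by rewrite -set2_of; apply: split_join.
- have [i [l' [El hl']]] : exists i l', l = NConn b args i :: l' /\
      path_to (child_sign b i) (args i) l' (e p) (Var p).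
    by case/path_inv: hl => [[]|].
  have [hP side _] : PIA_branch Omega e p (NConn b args i :: l').
    by rewrite -El; apply: tP.
  exists [:: (child_sign b i, residual_of i args s, args i)]; split.
  + move=> y [<-|//]; split=> /=.
    * move=> c q /(socc_residual hP)[/ncs//|[h hi]].
      by apply: (PIA_args hP side hi).1.
    (* The critical variable [p'] may differ from [p], so the side condition is taken from its own
       branch. *)
    * move=> q p' /(vars_residual hP) hq [l0 hl0].
      have hp' := path_app hl0; case: hq => [qs|[h hi qh]].
        by apply: sO => //; exists (NConn b args i :: l0).
      have [_ side' _] := tP p' _ hp'.
      exact: (PIA_args hP side' hi).2.
    * by move=> p' l0 /path_app/tP[].
  + rewrite big_seq1 /= ltnS (bigD1 i) //=; exact: leq_addr.
  + move=> Q a Qx; exists (@Residuation L) => //.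
    exists (sided b s (App args)), (sided (child_sign b i) (residual_of i args s) (args i)).
    split=> //; first exact: residuate_PIA.
    congr (replace_in _ _ _, _); apply/seteqP; split=> c /=; first by case=> [->|].
    by move=> ->; left.
Qed.

(** Only the terms still to be decomposed are measured; the displaced sides may grow. *)
Lemma decompose_all (r : seq (bool * term L * term L)) a :
  (forall x, List.In x r -> decomposable x) ->
  exists2 r', reaches (set_of (map ineq_of r), a) (set_of (map ineq_of r'), a) &
    forall x, List.In x r' -> decomposable x /\ decomposed x.
Proof.
have [n] := ubnP (\sum_(x <- r) tsize x.2); elim: n r => // n IH r hn hr.
have [[x [xr nx]]|all] := EM (exists x, List.In x r /\ ~ decomposed x); last first.
  exists r; first exact: reaches_refl.
  move=> x xr; split; first exact: hr.
  by apply: contrapT => nx; apply: all; exists x.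
have [B [hB wB step]] := decompose_step (hr x xr) nx.
have [r1 [E sub lt]] := replace_listed ineq_of (w := fun x => tsize x.2) xr wB.
have [] := step (set_of (map ineq_of r)) a.
  by apply/List.in_map_iff; exists x.
rewrite E => ru app piv; case: (IH r1).
- by apply: leq_trans lt _; rewrite -ltnS.
- by move=> y /sub[/hr|/hB].
- by move=> r' ra hr'; exists r' => //; apply: reaches_step app piv ra.
Qed.

(** * Elimination of the variables by the Ackermann rules *)

Definition solved (a : ineq L) := noncritical_ineq a \/
  exists p s, [/\ a = sided (e p) s (Var p), noncritical (~~ e p) s &
    forall q, q \in vars s -> Omega q p].

Lemma decomposed_solved x : decomposable x -> decomposed x -> solved (ineq_of x).
Proof.
case: x => [[b s] t] [/= ncs sO tP] [/= nct|/= [p Et Eb]].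
  by left; rewrite /ineq_of /=; case: b ncs nct {sO tP}.
right; exists p, s; rewrite Et Eb in ncs sO *; split=> // q qs.
by apply: sO => //; apply/socc_Var.
Qed.

(** What Ackermann's rule for [p] asks of the remaining inequalities, which may still bound other
    variables. *)
Definition noncritical_for p (a : ineq L) :=
  (forall c, signed_occ false (lhs a) c p -> c = ~~ e p) /\
  (forall c, signed_occ true (rhs a) c p -> c = ~~ e p).

Definition vars_ineq (a : ineq L) := vars (lhs a) ++ vars (rhs a).

Lemma vars_sided b s t q :
  (q \in vars_ineq (sided b s t)) = (q \in vars s) || (q \in vars t).
Proof. by rewrite mem_cat; case: b; rewrite //= orbC. Qed.

(** [A] collects the bounds of [p]. A bound of another variable has its only critical occurrence at
    that variable, so it goes to [B]. *)
Lemma solved_partition p (r : seq (ineq L)) :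
  (forall a, List.In a r -> solved a) ->
  exists A B, [/\
    set_of r = set_of (map (fun s => sided (e p) s (Var p)) A) `|` set_of B,
    forall s, List.In s A -> [/\ noncritical (~~ e p) s,
      forall q, q \in vars s -> Omega q p &
      List.In (sided (e p) s (Var p)) r] &
    forall a, List.In a B -> [/\ List.In a r, solved a & noncritical_for p a]].
Proof.
elim: r => [|a r IH] hr.
  by exists [::], [::]; split=> //; rewrite -set_of_cat.
have [|A [B [E hA hB]]] := IH; first by move=> c cr; apply: hr; right.
have Ec : set_of (a :: r) = [set a] `|` set_of r.
  by apply/seteqP; split=> c /= [->|h]; [left | right | left | right].
have [np|np] := EM (noncritical_for p a).
  exists A, (a :: B); split.
  - rewrite Ec E setUCA; congr (_ `|` _).
    by apply/seteqP; split=> c /= [->|h]; [left | right | left | right].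
  - by move=> s /hA[? ? ?]; split=> //; right.
  - move=> c [<-|/hB[? ? ?]]; split=> //; [by left | | by right].
    by apply: hr; left.
have [[ncl ncr]|[p' [s [Ea ncs sO]]]] := hr a (or_introl erefl).
  by case: np; split=> c; [apply: ncl | apply: ncr].
have Ep : p' = p.
  apply: contrapT => ne; apply: np; rewrite Ea.
  have ns b c : ~ signed_occ b (Var p') c p.
    by move/socc_Var => [_ E']; apply: ne.
  by case: (e p') ncs => ncs; split=> c /=; (try by move/ns); apply: ncs.
rewrite {p'}Ep in Ea ncs sO; exists (s :: A), B; split.
- rewrite Ec E setUA; congr (_ `|` _); rewrite Ea.
  by apply/seteqP; split=> c /= [->|h]; [left | right | left | right].
- move=> t [<-|/hA[? ? ?]]; split=> //; [by left | by right].
- by move=> c /hB[? ? ?]; split=> //; right.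
Qed.

Definition bound b (A : seq (term L)) := if b then joins A else meets A.

Lemma socc_bound b b' A c q : signed_occ b (bound b' A) c q ->
  exists2 s, List.In s A & signed_occ b s c q.
Proof.
case: A => [|s A]; first by case: b' => [/socc_Bot|/socc_Top].
have gen op : (forall t u, signed_occ b (op t u) c q <->
     signed_occ b t c q \/ signed_occ b u c q) ->
   signed_occ b (foldl op s A) c q ->
   exists2 t, List.In t (s :: A) & signed_occ b t c q.
  move=> hop; elim: A s => [|t A IH] s /=; first by exists s; [left|].
  case/IH => u [<-|uA] hu; last by exists u => //; right; right.
  by case/hop: hu => hu; [exists s; [left|] | exists t; [right; left|]].
by case: b' => /=; apply: gen => t u; [apply: socc_Join | apply: socc_Meet].
Qed.

Definition subst_ineq p t (a : ineq L) := Leq (subst p t (lhs a)) (subst p t (rhs a)).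

(** Converts lists to the indexed families in which the Ackermann rules are stated. *)
Lemma set_of_map (T : Type) (f : T -> ineq L) (r : seq T) :
  set_of (map f r) = range (fun i => f (tnth (in_tuple r) i)).
Proof.
apply/seteqP; split=> a.
- rewrite /set_of; elim: r => //= x r IH [<-|/IH[i _ <-]].
    by exists ord0; rewrite // (tnth_nth x).
  exists (lift ord0 i) => //; congr f.
  by rewrite !(tnth_nth x).
- case=> i _ <-; elim: r i => [[]//|x r IH] i.
  case: (unliftP ord0 i) => [j|] -> /=; last by left; rewrite (tnth_nth x).
  right; have := IH j; congr (List.In (f _) _).
  by rewrite !(tnth_nth x).
Qed.

(** Having only noncritical occurrences of [p] is the polarity condition of the right rule if [e p]
    is 1, and of the left rule otherwise. *)
Lemma Ackermann_step p (A : seq (term L)) (B : seq (ineq L)) (a : ineq L) :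
  (forall s, List.In s A -> p \notin vars s) -> pure_ineq a ->
  (forall c, List.In c B -> noncritical_for p c) ->
  exists2 r, apply_rule r
      (set_of (map (fun s => sided (e p) s (Var p)) A) `|` set_of B, a)
      (set_of (map (subst_ineq p (bound (e p) A)) B), a) &
    pivotal_rule r.
Proof.
move=> hA pa hB.
have tnth_In (T : Type) (r : seq T) i : List.In (tnth (in_tuple r) i) r.
  elim: r i => [[]//|x r IH] i; case: (unliftP ord0 i) => [j|] -> /=.
    right; have := IH j; congr List.In; by rewrite !(tnth_nth x).
  by left; rewrite (tnth_nth x).
have pA i : ~ occurs (Var p) (tnth (in_tuple A) i).
  by move/in_varsP; apply/negP/hA/tnth_In.
have npa : ~ occurs_ineq (Var p) a by case: pa => [h1 h2] [/h1|/h2].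
(* Left-hand sides are read with root sign - in [hB], while polarity refers to root sign +. *)
have hB1 i : forall c, signed_occ true (lhs (tnth (in_tuple B) i)) c p -> c = e p.
  by move=> c /socc_flip/(hB _ (tnth_In _ _ _)).1 /negb_inj.
have hB2 i : forall c, signed_occ true (rhs (tnth (in_tuple B) i)) c p -> c = ~~ e p.
  by move=> c /(hB _ (tnth_In _ _ _)).2.
have EA : codom (fun i => tnth (in_tuple A) i) = A.
  by rewrite /codom /image_mem; exact: (map_tnth_enum (in_tuple A)).
rewrite -[B in _ `|` set_of B]map_id !set_of_map.
have -> : (fun i => id (tnth (in_tuple B) i)) =
    (fun i => Leq (lhs (tnth (in_tuple B) i)) (rhs (tnth (in_tuple B) i))).
  by apply: funext => i; case: (tnth _ i).
rewrite /subst_ineq.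
have -> : bound (e p) A = bound (e p) (codom (fun i => tnth (in_tuple A) i)).
  by rewrite EA.
case: (e p) hB1 hB2 => hB1 hB2.
- exists (@RightAckermann L) => //; apply: right_Ackermann_rule => // i l c h.
    by apply: (hB1 i); exists l.
  by apply: (hB2 i); exists l.
- exists (@LeftAckermann L) => //; apply: left_Ackermann_rule => // i l c h.
    by apply: (hB1 i); exists l.
  by apply: (hB2 i); exists l.
Qed.

(** Bounds of [p] are inserted only at noncritical occurrences, where their own variables are
    noncritical too. If [p] occurs in a bound of [p'], transitivity puts the new variables below
    [p']. *)
Lemma solved_subst p A a :
  (forall s, List.In s A ->
     noncritical (~~ e p) s /\ forall q, q \in vars s -> Omega q p) ->
  solved a -> noncritical_for p a -> solved (subst_ineq p (bound (e p) A) a).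
Proof.
move=> hA sa [npl npr].
have gen b s : (forall c, signed_occ b s c p -> c = ~~ e p) -> noncritical b s ->
    noncritical b (subst p (bound (e p) A) s).
  move=> hp ns c q /socc_subst[[_]|[c' /hp-> /socc_bound[t /hA[nt _]]]].
    exact: ns.
  exact: nt.
case: sa => [[ncl ncr]|[p' [s [Ea ncs sO]]]].
  by left; split; apply: gen.
(* A bound of [p] would contain a critical occurrence of [p]. *)
have ne : p' != p.
  apply/eqP => E; rewrite {}Ea {}E in npl npr.
  have hv b : signed_occ b (Var p) b p by apply/socc_Var.
  by move: npl npr; case: (e p) => npl npr; [move: (npr _ (hv _))|move: (npl _ (hv _))].
right; exists p', (subst p (bound (e p) A) s); split.
- by rewrite Ea /subst_ineq; case: (e p') => /=; rewrite (negbTE ne).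
- apply: gen => // c; exact: ncs.
- move=> q /vars_subst[[_ /sO]//|[/sO pp' /(in_vars_socc true)[c]]].
  case/socc_bound => t /hA[_ ht] /socc_in_vars/ht qp.
  exact: Omega_trans qp pp'.
Qed.

(** Each step removes the head of [vs] and brings in no variable from outside the list; by
    irreflexivity no bound of [p] contains [p]. *)
Lemma Ackermann_all (vs : seq (PROP L)) (r : seq (ineq L)) a :
  (forall c, List.In c r -> solved c) -> pure_ineq a ->
  (forall c q, List.In c r -> q \in vars_ineq c -> q \in vs) ->
  exists2 Q, reaches (set_of r, a) Q & pure_system Q.
Proof.
elim: vs r => [|p vs IH] r hr pa hv.
  exists (set_of r, a); first exact: reaches_refl.
  split=> // c cr; split=> q /in_varsP hq.
    by have := hv c q cr; rewrite mem_cat hq => /(_ isT).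
  by have := hv c q cr; rewrite mem_cat hq orbT => /(_ isT).
have [A [B [E hA hB]]] := solved_partition p hr.
have pA s : List.In s A -> p \notin vars s.
  by case/hA => _ h _; apply/negP => /h; apply: Omega_irr.
have nB c : List.In c B -> noncritical_for p c by case/hB.
have [ru app piv] := Ackermann_step pA pa nB.
rewrite E; case: (IH (map (subst_ineq p (bound (e p) A)) B)) => //.
- move=> c /List.in_map_iff[d [<- /hB[_ sd nd]]]; apply: solved_subst => //.
  by move=> s /hA[].
- move=> c q /List.in_map_iff[d [<- /hB[dr sd nd]]] hq.
  have : q <> p /\ q \in p :: vs; last first.
    by case=> /eqP/negbTE ne; rewrite inE ne.
  have : exists2 s, s = lhs d \/ s = rhs d & q \in vars (subst p (bound (e p) A) s).
    move: hq; rewrite mem_cat => /orP[]; first by exists (lhs d); [left|].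
    by exists (rhs d); [right|].
  case=> s hs /vars_subst[[qp qs]|[_ /(in_vars_socc true)[c' /socc_bound[t tA]]]].
    split=> //; apply: (hv d) => //; rewrite mem_cat.
    by case: hs qs => -> ->; rewrite ?orbT.
  move/socc_in_vars => qt; have [_ _ tr] := hA _ tA; split.
    by move=> Eq; move: (pA t tA); rewrite -Eq qt.
  by apply: (hv _ _ tr); rewrite vars_sided qt.
- by move=> Q rQ pQ; exists Q => //; apply: reaches_step app piv rQ.
Qed.

Lemma prepared_run (a : ineq L) :
  prepared Omega e true (lhs a) -> ~~ Delta_root true (lhs a) ->
  prepared Omega e false (rhs a) -> ~~ Delta_root false (rhs a) ->
  exists2 Q, reaches (initial_system a) Q & pure_system Q.
Proof.
move=> l1 l2 r1 r2.
case: (@approximate_all [::] a) => //; [exact: prepared_skel | exact: prepared_skel |].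
move=> r [a' [ra hr pa']].
have [r' rr' hr'] := decompose_all a' hr.
case: (@Ackermann_all (\big[cat/[::]]_(c <- map ineq_of r') vars_ineq c)
        (map ineq_of r') a').
- by move=> c /List.in_map_iff[x [<- /hr'[]]]; apply: decomposed_solved.
- exact: pa'.
- move=> c q; elim: (map _ _) => //= d s IH [->|/IH h] hq; rewrite big_cons mem_cat.
    by rewrite hq.
  by rewrite h ?orbT.
- move=> Q rQ pQ; exists Q => //; apply: reaches_trans rQ.
  apply: reaches_trans rr'; move: ra; rewrite /initial_system.
  by have -> : set_of (map ineq_of [::]) = set0 by apply/seteqP; split.
Qed.

End Runs.

(** * Success of ALBA *)

Theorem theorem8p8 (L : LE_language) (phi psi : term L) :
  in_LE phi -> in_LE psi -> inductive_ineq (Leq phi psi) ->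
  exists E : execution (Leq phi psi), pivotal E /\ succeeds E.
Proof.
move=> hphi hpsi [Omega [e [irr trans hind]]].
have [a1 ex1 [LE1 ind1]] := eliminate_exhaustively (a := Leq phi psi) (conj hphi hpsi) hind.
have [a2 ex2 [LE2 ind2]] := distribute_exhaustively LE1 ind1.
have [nl nr] : (forall t, ~ distribute true (lhs a2) t) /\
    (forall t, ~ distribute false (rhs a2) t).
  case: ex2 => _; case: (a2) => s t n; split=> u d; apply: n.
    by exists (Leq u t); constructor.
  by exists (Leq s u); constructor.
have [S ex3 hS] :=
  splitting_exhaustively (And3 LE2.1 ind2.1 nl) (And3 LE2.2 ind2.2 nr).
(* With [S c] under the existential, choice yields the total function that [ex_run] has to be;
   outside [S] the empty run serves. *)
have run c : exists tr, S c -> [/\ is_run (initial_system c) tr,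
    pure_system (final_system (initial_system c) tr) &
    all (fun step => pivotal_rule step.1) tr].
  have [/hS[h1 h2 h3 h4]|nS] := EM (S c); last by exists [::].
  have [Q [tr [t1 <- t3]] pQ] := prepared_run irr trans h1 h2 h3 h4.
  by exists tr.
have [tr htr] := choice run.
have runP c (Sc : S c) : is_run (initial_system c) (tr c) by case: (htr c Sc).
by exists (Execution ex1 ex2 ex3 runP); split=> c /htr[].
Qed.
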